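(* Let $a$ be a complex number with $\operatorname{Re} a>0$. Then $$\int_0^\infty \frac{\sin 2x}{\cosh 2ax-\cos 2x}\,\frac{x\,dx}{x^2-\pi^2}=\frac{1}{2a}\,\frac{1+2a^2}{1+a^2}-\tan^{-1}\!\left(\frac1a\right).$$
   Context: $\tan^{-1}$ denotes the principal branch of the arctangent. The singularities of the integrand at $x=0$ and $x=\pi$ are removable. *)

(* Defs.v *)
From Stdlib Require Import Reals.
From Coquelicot Require Import Coquelicot.

Definition Cexp (z : C) : C :=
  (exp (Re z) * cos (Im z), exp (Re z) * sin (Im z))%R.

Definition Ccosh (z : C) : C := ((Cexp z + Cexp (- z)) / RtoC 2)%C.

(* Principal argument, with values in (-PI, PI] for z <> 0. *)
Definition Carg (z : C) : R :=
  if Rle_dec 0 (Im z) then acos (Re z / Cmod z) else (- acos (Re z / Cmod z))%R.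

(* Principal logarithm; the value at 0 is junk. *)
Definition Clog (z : C) : C := (ln (Cmod z), Carg z).

(* Principal branch of the arctangent: holomorphic off the two cuts
   { i y : |y| >= 1 } and extending the real arctangent.  For Re a > 0 the point
   1 / a has positive real part, hence lies off the cuts. *)
Definition Catan (z : C) : C :=
  (Ci / RtoC 2 * (Clog (RtoC 1 - Ci * z) - Clog (RtoC 1 + Ci * z)))%C.

(* At x = 0 and x = PI the quotient is given a junk value by the totalised
   division instead of its limit.  For Re a > 0 these are the only zeros of the
   denominators on [0, +oo), and the Riemann integral does not depend on the
   values taken there. *)
Definition integrand (a : C) (x : R) : C :=
  (RtoC (sin (2 * x)) / (Ccosh (RtoC 2 * a * RtoC x) - RtoC (cos (2 * x)))
   * (RtoC x / RtoC (x ^ 2 - PI ^ 2)))%C.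

(* Main.v *)
Require Import Defs.
From Stdlib Require Import Reals Lra Lia.
From Coquelicot Require Import Coquelicot.
Open Scope R_scope.

(** With [q = e^(-2 a x)] one has
      [sin 2x / (cosh 2ax - cos 2x) = 2 (sum over n >= 1 of q^n sin 2nx)],
    and [2 x sin 2nx / (x^2 - PI^2)] is the integral over [v] in [[0, 1]] of
    [4 n cos (2nvx) cos (2 PI n v)].  Exchanging the integrations, the [n]-th term
    integrates over [x >= 0] to the cosine coefficient
      [integral over [0, 1] of 2 h(v) cos (2 PI n v) dv, h(v) = a / (a^2 + v^2)].
    By Dirichlet's theorem at the endpoint these coefficients sum to
    [(h 0 + h 1) / 2 - integral of h], which is the claimed value.  The exchange of
    sum and integral rests on the bound [3 e^(-Re a N x) / (Re a)^2] for the
    remainder after [N] terms, whose integral is [O(1/N)]. *)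

(** * Interchange of integrals *)

(** Two limits meet here, the number [N] of terms and the upper end [b], and their order matters.
    The integrated remainder is bounded independently of [b], so [N] is fixed first. For this [N]
    the first [N] terms integrated over [[0, b]] miss their limits by at most
    [N (2 / Re a) e^(-2 Re a b)], and [b] is taken large afterwards. Hence integrals are exchanged
    only on bounded rectangles.

    The remainder bound has to survive the pole of [x / (x^2 - PI^2)] at [PI] and the double zero of
    [cosh 2ax - cos 2x] at [0]. The inequality [|sin 2nx| <= n x |x^2 - PI^2|] removes the pole and
    supplies one factor [x]; the weight supplies another. In the remainder, [sin 2Nx] must come with
    a single power of [1 / (1 - |q|)]: with two powers the integrated bound would be [O(1)] instead
    of [O(1/N)].

    Since [a] is complex, so is [h]. The Fourier argument is real and is applied to the real and
    imaginary parts, and the integral of [h] is recognised as the arctangent by comparing explicit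
    primitives in [atan] and [ln]. *)

Lemma continuous_RInt_param (f : R -> R -> R) (c d x0 : R) :
  (forall x y, continuity_2d_pt f x y) ->
  (forall x, ex_RInt (f x) c d) ->
  continuous (fun x => RInt (f x) c d) x0.
Proof.
  revert c d.
  assert (Hle : forall c d, c <= d -> (forall x y, continuity_2d_pt f x y) ->
    (forall x, ex_RInt (f x) c d) -> continuous (fun x => RInt (f x) c d) x0).
  2:{ intros c d Hc He. destruct (Rle_dec c d) as [h|h]; [now apply Hle|].
    apply continuous_ext with (fun x => opp (RInt (f x) d c)).
    { intros x. now apply opp_RInt_swap, ex_RInt_swap. }
    apply @continuous_opp. apply Hle; try lra; auto.
    intros x; now apply ex_RInt_swap. }
  intros c d hcd Hc He.
  apply continuity_pt_filterlim. intros eps Heps.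
  (* The [+ 1] keeps the denominator positive when [c = d]. *)
  assert (Hp : 0 < eps / (d - c + 1)) by (apply Rdiv_lt_0_compat; lra).
  destruct (uniform_continuity_2d_1d' f c d x0 (fun x _ => Hc x0 x) (mkposreal _ Hp)) as [del Hd].
  exists del; split; [apply del|]. intros x [_ Hx].
  simpl in *. unfold R_dist in *.
  rewrite <- (RInt_minus (V:=R_CompleteNormedModule)) by auto.
  apply Rle_lt_trans with ((d - c) * (eps / (d - c + 1))).
  - apply (norm_RInt_le_const (V:=R_NormedModule)
      (fun y => minus (f x y) (f x0 y)) c d); auto.
    + intros y Hy. apply Rlt_le. apply (Hd y x0 y x); auto.
      * pose proof (cond_pos del); lra.
      * apply Rabs_lt_between in Hx; lra.
      * rewrite Rminus_diag, Rabs_R0. apply del.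
    + apply @RInt_correct. apply @ex_RInt_minus; auto.
  - apply Rlt_le_trans with ((d - c + 1) * (eps / (d - c + 1))).
    + apply Rmult_lt_compat_r; lra.
    + right; field; lra.
Qed.

Lemma continuity_2d_pt_swap (f : R -> R -> R) (x y : R) :
  continuity_2d_pt f x y -> continuity_2d_pt (fun u v => f v u) y x.
Proof.
  intros H eps. destruct (H eps) as [d Hd]. exists d. intros u v Hu Hv. now apply Hd.
Qed.

Lemma continuous_2d_1 (f : R -> R -> R) (x y : R) :
  continuity_2d_pt f x y -> continuous (f x) y.
Proof.
  intros H. apply continuity_pt_filterlim. intros eps Heps.
  destruct (H (mkposreal eps Heps)) as [d Hd].
  exists d; split; [apply d|]. intros v [_ Hv]. apply Hd; auto.
  rewrite Rminus_diag, Rabs_R0. apply d.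
Qed.

(** Fubini on a rectangle by differentiation in one side: with [g u v] the integral of [f x v] for
    [x] from [a] to [u], the function [u |-> RInt (g u) c d] has derivative [A u] and vanishes at
    [u = a]. Its value at [u = b] is therefore the integral of [A], and by definition that of
    [B]. *)
Lemma is_RInt_swap_order (f : R -> R -> R) (A B : R -> R) (a b c d : R) :
  (forall x y, continuity_2d_pt f x y) ->
  (forall x, is_RInt (f x) c d (A x)) ->
  (forall v, is_RInt (fun x => f x v) a b (B v)) ->
  exists l, is_RInt A a b l /\ is_RInt B c d l.
Proof.
  intros Hf HA HB.
  set (g := fun u v => RInt (fun x => f x v) a u).
  assert (Hf' : forall x y, continuity_2d_pt (fun u v => f v u) x y)
    by (intros; now apply continuity_2d_pt_swap).
  assert (Hex : forall v u, ex_RInt (fun x => f x v) a u).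
  { intros v u. apply (ex_RInt_continuous (V:=R_CompleteNormedModule)). intros z _.
    now apply (continuous_2d_1 (fun u v => f v u)). }
  assert (Hg : forall u, ex_RInt (g u) c d).
  { intros u. apply (ex_RInt_continuous (V:=R_CompleteNormedModule)). intros z _.
    now apply (continuous_RInt_param (fun v x => f x v)). }
  assert (Hgd : forall u v, is_derive (fun z => g z v) u (f u v)).
  { intros u v. apply (is_derive_RInt (fun x => f x v) (fun z => g z v) a u).
    - exists (mkposreal 1 Rlt_0_1). intros y _. apply @RInt_correct, Hex.
    - now apply (continuous_2d_1 (fun u v => f v u)). }
  assert (HF : forall u, is_derive (fun z => RInt (g z) c d) u (A u)).
  { intros u.
    replace (A u) with (RInt (fun v => Derive (fun z => g z v) u) c d).
    - apply is_derive_RInt_param.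
      + exists (mkposreal 1 Rlt_0_1). intros y _ t _. eexists; apply Hgd.
      + intros t _. apply continuity_2d_pt_ext with f; auto.
        intros x y. symmetry. apply is_derive_unique, Hgd.
      + exists (mkposreal 1 Rlt_0_1). intros y _. apply Hg.
    - rewrite <- (is_RInt_unique _ _ _ _ (HA u)). apply RInt_ext.
      intros x _. apply is_derive_unique, Hgd. }
  exists (RInt (g b) c d). split.
  - assert (H := is_RInt_derive (V:=R_CompleteNormedModule)
      (fun z => RInt (g z) c d) A a b (fun x _ => HF x)).
    assert (E : minus (RInt (g b) c d) (RInt (g a) c d) = RInt (g b) c d).
    { replace (RInt (g a) c d) with 0.
      - unfold minus, plus, opp; simpl; ring.
      - rewrite (RInt_ext _ (fun _ => 0)).
        + rewrite RInt_const. unfold scal; simpl. unfold mult; simpl. ring.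
        + intros v _. unfold g. apply @RInt_point. }
    rewrite <- E. apply H. intros x _.
    apply continuous_ext with (fun x => RInt (f x) c d).
    + intros t. now apply is_RInt_unique.
    + apply continuous_RInt_param; auto. intros t; eexists; apply HA.
  - apply is_RInt_ext with (g b).
    + intros v _. now apply is_RInt_unique.
    + now apply @RInt_correct.
Qed.

(** * Dirichlet's theorem at the endpoints of a period *)

Definition dirichlet (N : nat) (v : R) : R :=
  1 + sum_n_m (fun n => 2 * cos (2 * PI * INR n * v)) 1 N.

(** The antiderivative of [dirichlet N], and at the same time [v - 1/2] minus the [N]-th partial sum
    of its Fourier series on [(0, 1)]. The constant [-1/2] makes it odd about [v = 1/2], so that it
    takes the values [-1/2] and [1/2] at the two ends for every [N]; these give the weights of [h 0]
    and [h 1]. *)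
Definition sawtooth (N : nat) (v : R) : R :=
  v - 1 / 2 + sum_n_m (fun n => sin (2 * PI * INR n * v) / (PI * INR n)) 1 N.

Lemma sum_1_0 {G : AbelianMonoid} (u : nat -> G) : sum_n_m u 1 0 = zero.
Proof. now apply sum_n_m_zero; lia. Qed.

Lemma sum_1_S {G : AbelianMonoid} (u : nat -> G) (N : nat) :
  sum_n_m u 1 (S N) = plus (sum_n_m u 1 N) (u (S N)).
Proof. apply sum_n_Sm; lia. Qed.

Lemma INR_S_pos (n : nat) : 0 < INR (S n).
Proof. apply lt_0_INR; lia. Qed.

Lemma dirichlet_S N v : dirichlet (S N) v = dirichlet N v + 2 * cos (2 * PI * INR (S N) * v).
Proof. unfold dirichlet. rewrite sum_1_S. unfold plus; simpl plus; simpl; ring. Qed.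

Lemma sawtooth_S N v :
  sawtooth (S N) v = sawtooth N v + sin (2 * PI * INR (S N) * v) / (PI * INR (S N)).
Proof. unfold sawtooth. rewrite sum_1_S. unfold plus; simpl plus; simpl AbelianMonoid.sort; cbn -[INR]; ring. Qed.

Lemma dirichlet_0 v : dirichlet 0 v = 1.
Proof. unfold dirichlet. rewrite sum_1_0. unfold zero; simpl; ring. Qed.

Lemma sawtooth_0 v : sawtooth 0 v = v - 1 / 2.
Proof. unfold sawtooth. rewrite sum_1_0. unfold zero; simpl; ring. Qed.

Lemma is_derive_sawtooth N v : is_derive (sawtooth N) v (dirichlet N v).
Proof.
  induction N as [|N IH].
  - apply is_derive_ext with (fun v => v - 1 / 2).
    + intros t. now rewrite sawtooth_0.
    + rewrite dirichlet_0. auto_derive; auto; ring.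
  - apply is_derive_ext with
      (fun v => sawtooth N v + sin (2 * PI * INR (S N) * v) / (PI * INR (S N))).
    + intros t. now rewrite sawtooth_S.
    + rewrite dirichlet_S. apply @is_derive_plus; auto.
      pose proof PI_RGT_0. generalize (INR_S_pos N). generalize (INR (S N)). intros k Hk.
      auto_derive; auto. field. split; lra.
Qed.

Lemma dirichlet_continuous N v : continuous (dirichlet N) v.
Proof.
  induction N as [|N IH].
  - apply continuous_ext with (fun _ => 1).
    + intros; now rewrite dirichlet_0.
    + apply continuous_const.
  - apply continuous_ext with
      (fun v => dirichlet N v + 2 * cos (2 * PI * INR (S N) * v)).
    + intros; now rewrite dirichlet_S.
    + apply @continuous_plus; auto.
      apply @ex_derive_continuous. auto_derive; auto.
Qed.

(** The sum telescopes, as [2 cos (2 PI n v) sin (PI v)] is the difference of the sines of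
    [(2n + 1) PI v] and [(2n - 1) PI v]. *)
Lemma dirichlet_sin N v :
  dirichlet N v * sin (PI * v) = sin ((2 * INR N + 1) * PI * v).
Proof.
  induction N as [|N IH].
  - rewrite dirichlet_0. simpl. rewrite Rmult_1_l. f_equal; ring.
  - rewrite dirichlet_S, Rmult_plus_distr_r, IH, S_INR.
    replace ((2 * INR N + 1) * PI * v) with (2 * PI * (INR N + 1) * v - PI * v) by ring.
    replace ((2 * (INR N + 1) + 1) * PI * v) with (2 * PI * (INR N + 1) * v + PI * v) by ring.
    rewrite sin_minus, sin_plus; ring.
Qed.

Lemma sin_nat_PI (n : nat) : sin (INR n * PI) = 0.
Proof. rewrite INR_IZR_INZ. apply sin_eq_0_1. now exists (Z.of_nat n). Qed.

Lemma cos_odd_PI2 (n : nat) : cos ((2 * INR n + 1) * PI * (1 / 2)) = 0.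
Proof.
  replace ((2 * INR n + 1) * PI * (1 / 2)) with (INR n * PI + PI / 2) by field.
  rewrite cos_plus, cos_PI2, sin_nat_PI; ring.
Qed.

Lemma sawtooth_half N : sawtooth N (1 / 2) = 0.
Proof.
  induction N as [|N IH].
  - rewrite sawtooth_0; lra.
  - rewrite sawtooth_S, IH.
    replace (2 * PI * INR (S N) * (1 / 2)) with (INR (S N) * PI) by field.
    rewrite sin_nat_PI. unfold Rdiv; ring.
Qed.

Lemma sin_lin_bound x : Rabs (sin x) <= Rabs x.
Proof.
  destruct (MVT_gen sin 0 x cos) as [c [_ Hc]].
  - intros; apply is_derive_Reals, derivable_pt_lim_sin.
  - intros; apply continuity_sin.
  - rewrite sin_0, !Rminus_0_r in Hc. rewrite Hc, Rabs_mult.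
    rewrite <- (Rmult_1_l (Rabs x)) at 2.
    apply Rmult_le_compat_r; [apply Rabs_pos|].
    apply Rabs_le, COS_bound.
Qed.

Lemma sawtooth_sym N v : sawtooth N (1 - v) = - sawtooth N v.
Proof.
  induction N as [|N IH].
  - rewrite !sawtooth_0; lra.
  - rewrite !sawtooth_S, IH.
    replace (2 * PI * INR (S N) * (1 - v))
      with (- (2 * PI * INR (S N) * v) + 2 * INR (S N) * PI) by ring.
    rewrite sin_period, sin_neg. unfold Rdiv; ring.
Qed.

Lemma sawtooth_at_0 N : sawtooth N 0 = - (1 / 2).
Proof.
  induction N as [|N IH].
  - rewrite sawtooth_0; lra.
  - rewrite sawtooth_S, IH, Rmult_0_r, sin_0. unfold Rdiv; ring.
Qed.

Lemma sawtooth_at_1 N : sawtooth N 1 = 1 / 2.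
Proof. rewrite <- (Rminus_0_r 1) at 1. rewrite sawtooth_sym, sawtooth_at_0. ring. Qed.

Lemma sin_PI_lower v : 0 <= v <= 1 / 2 -> v <= sin (PI * v).
Proof.
  intros Hv. pose proof PI2_3_2. pose proof PI_4.
  (* Cubic Taylor bound [y - y^3/6 <= sin y]. For [0 <= y <= 2] the left side is at least [y / 3],
     and [PI >= 3] turns this into [v]. *)
  destruct (pre_sin_bound (PI * v) 0) as [Hs _]; try nra.
  unfold sin_approx, sin_term in Hs. simpl in Hs.
  assert (0 <= PI * v <= 2) by nra.
  set (y := PI * v) in *.
  assert (y / 3 <= sin y).
  { eapply Rle_trans; [|apply Hs].
    assert (0 <= y * (4 - y * y)) by nra. lra. }
  unfold y in *. nra.
Qed.

(** A monotonicity argument in place of a second mean value theorem. With [k = 2N + 1], adding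
    [(cos (k PI t) + e) / (k PI sin (PI t))] to [sawtooth N t] cancels the oscillating derivative
    [sin (k PI t) / sin (PI t)] and leaves one proportional to [-(cos (k PI t) + e)]. This has a
    constant sign for [e = 1] and for [e = -1], which yields the lower and the upper bound. At
    [t = 1/2] both [sawtooth] and [cos (k PI t)] vanish, [k] being odd. *)
Lemma sawtooth_decay N v :
  0 < v <= 1 / 2 -> Rabs (sawtooth N v) <= 1 / ((2 * INR N + 1) * v).
Proof.
  intros Hv. pose proof PI2_3_2. pose proof PI_RGT_0. pose proof (pos_INR N).
  set (k := 2 * INR N + 1). assert (1 <= k) by (unfold k; lra).
  assert (Hs : forall t, v <= t <= 1 / 2 -> 0 < sin (PI * t)).
  { intros t Ht. pose proof (sin_PI_lower t). lra. }
  assert (Hc0 : forall t, v <= t <= 1 / 2 -> 0 <= cos (PI * t)).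
  { intros t Ht. apply cos_ge_0; nra. }
  assert (Hmvt : forall e, exists c, v <= c <= 1 / 2 /\
     sawtooth N v + (cos (k * PI * v) + e) / (k * PI * sin (PI * v)) =
     e / (k * PI) + cos (PI * c) / (k * Rsqr (sin (PI * c))) * (cos (k * PI * c) + e) * (1 / 2 - v)).
  { intros e.
    set (G := fun t => sawtooth N t + (cos (k * PI * t) + e) / (k * PI * sin (PI * t))).
    set (dG := fun t => - (cos (PI * t) / (k * Rsqr (sin (PI * t))) * (cos (k * PI * t) + e))).
    assert (HG : forall t, v <= t <= 1 / 2 -> is_derive G t (dG t)).
    { intros t Ht. specialize (Hs t Ht).
      replace (dG t) with (dirichlet N t +
        ((- (k * PI * sin (k * PI * t))) * (k * PI * sin (PI * t))
         - (cos (k * PI * t) + e) * (k * PI * (PI * cos (PI * t))))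
          / Rsqr (k * PI * sin (PI * t))).
      - apply @is_derive_plus; [apply is_derive_sawtooth|].
        auto_derive.
        + apply Rgt_not_eq, Rmult_lt_0_compat; [apply Rmult_lt_0_compat|]; lra.
        + unfold Rsqr. field. repeat split; lra.
      - assert (Hd := dirichlet_sin N t). fold k in Hd. rewrite <- Hd. unfold dG, Rsqr.
        field. repeat split; lra. }
    destruct (MVT_gen G v (1 / 2) dG) as [c [Hc E]].
    - intros x Hx. apply HG. rewrite Rmin_left, Rmax_right in Hx; lra.
    - intros x Hx. rewrite Rmin_left, Rmax_right in Hx by lra.
      apply continuity_pt_filterlim, (ex_derive_continuous (V:=R_NormedModule)).
      eexists; apply HG; auto.
    - rewrite Rmin_left, Rmax_right in Hc by lra.
      exists c; split; auto.
      assert (E1 : G (1 / 2) = e / (k * PI)).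
      { unfold G, k. rewrite sawtooth_half, cos_odd_PI2.
        replace (PI * (1 / 2)) with (PI / 2) by field. rewrite sin_PI2.
        fold k. field. lra. }
      rewrite E1 in E. fold (G v). unfold dG in E. lra. }
  assert (Hpos : forall c, v <= c <= 1 / 2 -> 0 <= cos (PI * c) / (k * Rsqr (sin (PI * c)))).
  { intros c Hc. specialize (Hs c Hc). apply Rle_mult_inv_pos; auto. unfold Rsqr.
    apply Rmult_lt_0_compat; [lra|nra]. }
  assert (Hv' := Hs v ltac:(lra)).
  assert (HP : 0 < / (k * PI)) by (apply Rinv_0_lt_compat; nra).
  assert (HD : 0 < / (k * PI * sin (PI * v))).
  { apply Rinv_0_lt_compat, Rmult_lt_0_compat; [apply Rmult_lt_0_compat|]; lra. }
  (* The numerator [cos (k PI v) + e] has absolute value at most 2; the rest is [PI >= 2] and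
     [sin (PI v) >= v]. *)
  assert (Hb : 2 * / (k * PI * sin (PI * v)) <= 1 / (k * v)).
  { replace (1 / (k * v)) with (2 * / (k * 2 * v)) by (field; lra).
    apply Rmult_le_compat_l; [lra|]. apply Rinv_le_contravar; [nra|].
    assert (Hl := sin_PI_lower v ltac:(lra)).
    rewrite !Rmult_assoc. apply Rmult_le_compat_l; [lra|]. nra. }
  pose proof (COS_bound (k * PI * v)).
  apply Rle_trans with (2 := Hb). apply Rabs_le. split.
  - destruct (Hmvt 1) as [c [Hc E]]. specialize (Hpos c Hc).
    pose proof (COS_bound (k * PI * c)).
    assert (0 <= cos (PI * c) / (k * Rsqr (sin (PI * c))) * (cos (k * PI * c) + 1) * (1 / 2 - v)).
    { apply Rmult_le_pos; [apply Rmult_le_pos|]; lra. }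
    unfold Rdiv in *. nra.
  - destruct (Hmvt (-1)) as [c [Hc E]]. specialize (Hpos c Hc).
    pose proof (COS_bound (k * PI * c)).
    assert (0 <= cos (PI * c) / (k * Rsqr (sin (PI * c))) * - (cos (k * PI * c) + -1) * (1 / 2 - v)).
    { apply Rmult_le_pos; [apply Rmult_le_pos|]; lra. }
    unfold Rdiv in *. nra.
Qed.

Lemma sawtooth_small N v : 0 <= v <= 1 / 2 -> Rabs (sawtooth N v) <= 1 / 2 + 2 * INR N * v.
Proof.
  intros Hv. induction N as [|N IH].
  - rewrite sawtooth_0. simpl. apply Rabs_le; lra.
  - rewrite sawtooth_S. eapply Rle_trans; [apply Rabs_triang|].
    pose proof (INR_S_pos N). pose proof PI_RGT_0.
    assert (Rabs (sin (2 * PI * INR (S N) * v) / (PI * INR (S N))) <= 2 * v).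
    { unfold Rdiv. rewrite Rabs_mult.
      rewrite (Rabs_pos_eq (/ _)) by (left; apply Rinv_0_lt_compat; nra).
      apply Rle_trans with (Rabs (2 * PI * INR (S N) * v) * / (PI * INR (S N))).
      - apply Rmult_le_compat_r; [left; apply Rinv_0_lt_compat; nra|]. apply sin_lin_bound.
      - rewrite Rabs_pos_eq; [right; field; split; lra|].
        apply Rmult_le_pos; [apply Rmult_le_pos|]; lra. }
    rewrite S_INR in *. lra.
Qed.

(** Near the ends the Gibbs phenomenon rules out smallness, but a bound uniform in [N] remains:
    [sawtooth_small] serves while [(2N + 1) v <= 1], [sawtooth_decay] beyond, and the symmetry about
    [1/2] does the other half. *)
Lemma sawtooth_bounded N v : 0 <= v <= 1 -> Rabs (sawtooth N v) <= 2.
Proof.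
  assert (H : forall v, 0 <= v <= 1 / 2 -> Rabs (sawtooth N v) <= 2).
  { clear v. intros v Hv. pose proof (pos_INR N).
    destruct (Rle_dec ((2 * INR N + 1) * v) 1) as [h|h].
    - pose proof (sawtooth_small N v Hv). nra.
    - assert (Hv0 : 0 < v) by (destruct (Req_dec v 0) as [->|]; lra).
      eapply Rle_trans; [apply sawtooth_decay; lra|].
      apply Rle_trans with (1 / 1); [|lra].
      apply Rmult_le_compat_l; [lra|]. apply Rinv_le_contravar; lra. }
  intros Hv. destruct (Rle_dec v (1 / 2)); [apply H; lra|].
  rewrite <- Rabs_Ropp, <- sawtooth_sym. apply H; lra.
Qed.

Lemma sawtooth_middle N v d : 0 < d -> d <= v <= 1 - d ->
  Rabs (sawtooth N v) <= 1 / ((2 * INR N + 1) * d).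
Proof.
  intros Hd Hv. pose proof (pos_INR N).
  assert (H' : forall v, d <= v <= 1 / 2 -> Rabs (sawtooth N v) <= 1 / ((2 * INR N + 1) * d)).
  { clear v Hv. intros v Hv. eapply Rle_trans; [apply sawtooth_decay; lra|].
    apply Rmult_le_compat_l; [lra|]. apply Rinv_le_contravar; nra. }
  destruct (Rle_dec v (1 / 2)); [apply H'; lra|].
  rewrite <- Rabs_Ropp, <- sawtooth_sym. apply H'; lra.
Qed.

(** * Cosine coefficients of a continuously differentiable function on [[0, 1]] *)

Section Fourier.
Variables h h' : R -> R.
Hypothesis Hh : forall v, is_derive h v (h' v).
Hypothesis Hc : forall v, continuous h' v.

Let hcont v : continuous h v.
Proof. apply (ex_derive_continuous (V:=R_NormedModule)). eexists; apply Hh. Qed.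

Let sawcont N v : continuous (sawtooth N) v.
Proof. apply (ex_derive_continuous (V:=R_NormedModule)). eexists; apply is_derive_sawtooth. Qed.

Let excos n : ex_RInt (fun v => 2 * cos (2 * PI * INR n * v) * h v) 0 1.
Proof.
  apply (ex_RInt_continuous (V:=R_CompleteNormedModule)). intros z _.
  apply @continuous_mult; auto. apply @ex_derive_continuous. auto_derive; auto.
Qed.

Lemma sum_cos_coeff N :
  is_RInt (fun v => h v * dirichlet N v) 0 1
    (RInt h 0 1 + sum_n_m (fun n => RInt (fun v => 2 * cos (2 * PI * INR n * v) * h v) 0 1) 1 N).
Proof.
  induction N as [|N IH].
  - rewrite sum_1_0. unfold zero; simpl. rewrite Rplus_0_r.
    apply is_RInt_ext with h.
    + intros; now rewrite dirichlet_0, Rmult_1_r.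
    + apply (RInt_correct (V:=R_CompleteNormedModule)), (ex_RInt_continuous (V:=R_CompleteNormedModule)); auto.
  - rewrite sum_1_S. unfold plus; simpl plus. cbn -[INR].
    rewrite <- Rplus_assoc.
    eapply is_RInt_ext.
    2:{ apply @is_RInt_plus; [apply IH|]. exact (RInt_correct (V:=R_CompleteNormedModule) _ _ _ (excos (S N))). }
    intros x _. rewrite dirichlet_S. unfold plus; cbn -[INR]. ring.
Qed.

(** Integration by parts of [h * dirichlet N]; the boundary term is [(h 0 + h 1) / 2] because
    [sawtooth N] is [1/2] at 1 and [-1/2] at 0. It gives the error of the endpoint sum exactly, as
    an integral against [h']. *)
Lemma dirichlet_by_parts N :
  is_RInt (fun v => h' v * sawtooth N v) 0 1
    ((h 0 + h 1) / 2 - (RInt h 0 1 +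
      sum_n_m (fun n => RInt (fun v => 2 * cos (2 * PI * INR n * v) * h v) 0 1) 1 N)).
Proof.
  assert (H1 : is_RInt (fun v => h' v * sawtooth N v + h v * dirichlet N v) 0 1
     ((h 0 + h 1) / 2)).
  { replace ((h 0 + h 1) / 2) with (minus (h 1 * sawtooth N 1) (h 0 * sawtooth N 0)).
    - apply (is_RInt_derive (V:=R_CompleteNormedModule) (fun v => h v * sawtooth N v)).
      + intros x _. apply (is_derive_mult h (sawtooth N) x (h' x) (dirichlet N x)); auto.
        * apply is_derive_sawtooth.
        * intros; apply Rmult_comm.
      + intros x _. apply @continuous_plus; apply @continuous_mult; auto.
        apply dirichlet_continuous.
    - rewrite sawtooth_at_1, sawtooth_at_0.
      unfold minus, plus, opp; simpl. field. }
  eapply is_RInt_ext.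
  2: apply (is_RInt_minus _ _ _ _ _ _ H1 (sum_cos_coeff N)).
  intros x _. unfold minus, plus, opp; simpl. ring.
Qed.

(** The two end pieces have length [d] and use the uniform bound 2, hence [4 * d]; on the middle
    piece [sawtooth] is small for large [N]. *)
Lemma sawtooth_integral_small M d N I :
  (forall v, 0 <= v <= 1 -> Rabs (h' v) <= M) -> 0 < d < 1 / 2 ->
  is_RInt (fun v => h' v * sawtooth N v) 0 1 I ->
  Rabs I <= M * (4 * d + 1 / ((2 * INR N + 1) * d)).
Proof.
  intros HM Hd HI.
  assert (HM0 : 0 <= M) by (eapply Rle_trans; [apply Rabs_pos|apply (HM 0); lra]).
  set (f := fun v => h' v * sawtooth N v) in *.
  assert (Hex : forall a b, ex_RInt f a b).
  { intros. apply (ex_RInt_continuous (V:=R_CompleteNormedModule)). intros z _.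
    apply @continuous_mult; auto. }
  assert (Hsp : I = RInt f 0 d + (RInt f d (1 - d) + RInt f (1 - d) 1)).
  { rewrite <- (is_RInt_unique _ _ _ _ HI).
    pose proof (RInt_Chasles f 0 d 1 (Hex _ _) (Hex _ _)) as E1.
    pose proof (RInt_Chasles f d (1 - d) 1 (Hex _ _) (Hex _ _)) as E2.
    unfold plus in E1, E2; simpl in E1, E2. now rewrite E2, E1. }
  assert (Hb : forall a b K, 0 <= a <= b -> b <= 1 ->
     (forall v, a <= v <= b -> Rabs (sawtooth N v) <= K) -> Rabs (RInt f a b) <= (b - a) * (M * K)).
  { intros a b K Hab Hb1 HK.
    apply (norm_RInt_le_const (V:=R_NormedModule) f a b).
    - lra.
    - intros x Hx. unfold norm; simpl; unfold abs; simpl. unfold f. rewrite Rabs_mult.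
      apply Rmult_le_compat; try apply Rabs_pos; [apply HM; lra|apply HK; lra].
    - apply (RInt_correct (V:=R_CompleteNormedModule)), Hex. }
  pose proof (Hb 0 d 2 ltac:(lra) ltac:(lra) (fun v Hv => sawtooth_bounded N v ltac:(lra))).
  pose proof (Hb (1 - d) 1 2 ltac:(lra) ltac:(lra) (fun v Hv => sawtooth_bounded N v ltac:(lra))).
  pose proof (Hb d (1 - d) _ ltac:(lra) ltac:(lra) (fun v Hv => sawtooth_middle N v d ltac:(lra) Hv)).
  assert (0 <= 1 / ((2 * INR N + 1) * d)).
  { apply Rle_mult_inv_pos; [lra|]. pose proof (pos_INR N). nra. }
  set (K := 1 / ((2 * INR N + 1) * d)) in *.
  assert ((1 - d - d) * (M * K) <= M * K) by (assert (0 <= M * K) by nra; nra).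
  rewrite Hsp. eapply Rle_trans; [apply Rabs_triang|].
  eapply Rle_trans; [apply Rplus_le_compat_l, Rabs_triang|]. lra.
Qed.

Lemma fourier_endpoint_sum :
  is_lim_seq (fun N => sum_n_m (fun n => RInt (fun v => 2 * cos (2 * PI * INR n * v) * h v) 0 1) 1 N)
    ((h 0 + h 1) / 2 - RInt h 0 1).
Proof.
  destruct (continuity_ab_maj (fun v => Rabs (h' v)) 0 1) as [Mx [HMx _]]; [lra| |].
  { intros c _. apply continuity_pt_filterlim.
    apply (continuous_comp h' Rabs); auto. apply continuous_Rabs. }
  (* The [+ 1] makes [M] positive, since [d] below divides by it. *)
  set (M := Rabs (h' Mx) + 1).
  assert (HM : 0 < M) by (unfold M; pose proof (Rabs_pos (h' Mx)); lra).
  apply is_lim_seq_spec. intros eps.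
  (* The second entry bounds the end pieces by [eps / 4]; the cap [1 / 4] keeps [d] below [1 / 2].
     Then [N0] is taken so that the middle piece is also at most [eps / 4]. *)
  set (d := Rmin (1 / 4) (eps / (16 * M))).
  assert (Heps := cond_pos eps).
  assert (Hd0 : 0 < eps / (16 * M)) by (apply Rdiv_lt_0_compat; lra).
  assert (Hd : 0 < d < 1 / 2).
  { unfold d. split; [apply Rmin_glb_lt; lra|]. eapply Rle_lt_trans; [apply Rmin_l|lra]. }
  assert (Hd1 : M * (4 * d) <= eps / 4).
  { assert (d <= eps / (16 * M)) by apply Rmin_r.
    apply Rle_trans with (M * (4 * (eps / (16 * M)))); [nra|right; field; lra]. }
  destruct (nfloor_ex (M * 4 / (eps * d))) as [N0 [_ HN0]].
  { apply Rle_mult_inv_pos; nra. }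
  exists (S N0). intros N HN.
  assert (HMb : forall v, 0 <= v <= 1 -> Rabs (h' v) <= M).
  { intros v Hv. specialize (HMx v Hv). unfold M. lra. }
  pose proof (sawtooth_integral_small M d N _ HMb Hd (dirichlet_by_parts N)) as Hb.
  set (s := sum_n_m _ _ _) in *.
  replace (s - _) with (- ((h 0 + h 1) / 2 - (RInt h 0 1 + s))) by ring.
  rewrite Rabs_Ropp. eapply Rle_lt_trans; [apply Hb|].
  assert (HN1 : INR N0 + 1 <= INR N) by (rewrite <- S_INR; now apply le_INR).
  pose proof (pos_INR N0).
  assert (M * 4 < eps * d * (2 * INR N + 1)).
  { assert (HX : M * 4 / (eps * d) < 2 * INR N + 1) by lra.
    apply Rmult_lt_compat_l with (r := eps * d) in HX; [|nra].
    replace (eps * d * (M * 4 / (eps * d))) with (M * 4) in HX by (field; lra). lra. }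
  assert (Hq : 0 < (2 * INR N + 1) * d) by nra.
  assert (M * (1 / ((2 * INR N + 1) * d)) <= eps / 4).
  { apply Rmult_le_reg_r with (1 := Hq).
    replace (M * (1 / ((2 * INR N + 1) * d)) * ((2 * INR N + 1) * d)) with M by (field; lra). nra. }
  lra.
Qed.
End Fourier.

(** * Complex-valued integrals and the terms of the series *)

(** Goals left by [is_RInt_ext] live in the carrier of a normed module; restated at type [C], they
    are accepted by [ring] and [field]. *)
Ltac eq_C := match goal with |- @eq _ ?x ?y => change (@eq C x y) end.

Ltac eq_R := match goal with |- @eq _ ?x ?y => change (@eq R x y) end.

Lemma norm_Cmod (z : C) : norm (V := C_R_NormedModule) z = Cmod z.
Proof.
  unfold norm; simpl. unfold prod_norm, Cmod, norm; simpl. unfold abs; simpl.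
  f_equal.
  rewrite !Rmult_1_r, <- !Rabs_mult, !Rabs_pos_eq; auto using Rle_0_sqr;
  apply Rle_0_sqr.
Qed.

Lemma Cexp_plus (z w : C) : Cexp (z + w) = (Cexp z * Cexp w)%C.
Proof.
  unfold Cexp, Cmult; destruct z as [x y], w as [x' y']; simpl.
  rewrite exp_plus, cos_plus, sin_plus. f_equal; ring.
Qed.

Lemma Cexp_0 : Cexp (RtoC 0) = RtoC 1.
Proof. unfold Cexp, RtoC; simpl. rewrite exp_0, cos_0, sin_0. f_equal; ring. Qed.

Lemma Cmod_Cexp (z : C) : Cmod (Cexp z) = exp (Re z).
Proof.
  unfold Cexp, Cmod; simpl.
  transitivity (sqrt (Rsqr (exp (Re z)))).
  - f_equal. pose proof (sin2_cos2 (Im z)) as H. unfold Rsqr in *. nra.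
  - apply sqrt_Rsqr. left; apply exp_pos.
Qed.

Lemma Cexp_neq_0 (z : C) : Cexp z <> RtoC 0.
Proof. apply Cmod_gt_0. rewrite Cmod_Cexp. apply exp_pos. Qed.

Lemma Cexp_Ci_cos (y : R) :
  (Cexp (Ci * RtoC y) + Cexp (- (Ci * RtoC y)))%C = RtoC (2 * cos y).
Proof.
  unfold Cexp, Cplus, Copp, Cmult, Ci, RtoC; simpl.
  replace (0 * y - 1 * 0) with 0 by ring. replace (0 * 0 + 1 * y) with y by ring.
  rewrite Ropp_0, exp_0, sin_neg, cos_neg. f_equal; ring.
Qed.

Lemma is_derive_C (f1 f2 : R -> R) (x l1 l2 : R) :
  is_derive f1 x l1 -> is_derive f2 x l2 ->
  is_derive (V := C_R_NormedModule) (fun t => (f1 t, f2 t)) x (l1, l2).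
Proof.
  intros H1 H2.
  apply is_derive_ext with
    (fun t => plus (scal (V := C_R_NormedModule) (f1 t) (1, 0)) (scal (f2 t) (0, 1))).
  { intros t. unfold scal, plus; simpl. unfold prod_scal, prod_plus, scal, plus; simpl.
    unfold mult; simpl. f_equal; ring. }
  replace (l1, l2) with
    (plus (scal (V := C_R_NormedModule) l1 (1, 0)) (scal l2 (0, 1))).
  - apply @is_derive_plus; apply @is_derive_scal_l; auto.
  - unfold scal, plus; simpl. unfold prod_scal, prod_plus, scal, plus; simpl.
    unfold mult; simpl. f_equal; ring.
Qed.

Lemma continuous_C (f : R -> C) (x : R) :
  continuous (fun t => fst (f t)) x -> continuous (fun t => snd (f t)) x ->
  continuous (U := C_UniformSpace) f x.
Proof.
  intros H1 H2. apply continuous_ext with (fun t => (fst (f t), snd (f t))).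
  - intros t. now destruct (f t).
  - apply (continuous_comp_2 (fun t => fst (f t)) (fun t => snd (f t)) pair); auto.
    apply (continuous_ext (fun z => z)).
    + now intros [].
    + apply continuous_id.
Qed.

Lemma is_derive_Cexp_lin (c z : C) (x : R) :
  is_derive (V := C_R_NormedModule) (fun t => c * Cexp (z * RtoC t))%C x
    (c * (z * Cexp (z * RtoC x)))%C.
Proof.
  destruct c as [c1 c2], z as [z1 z2].
  unfold Cexp, Cmult, RtoC; simpl.
  apply is_derive_C; auto_derive; auto; unfold Rminus; ring.
Qed.

Lemma continuous_Cexp_lin (c z : C) (x : R) :
  continuous (U := C_UniformSpace) (fun t => c * Cexp (z * RtoC t))%C x.
Proof.
  apply (ex_derive_continuous (V := C_R_NormedModule)). eexists; apply is_derive_Cexp_lin.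
Qed.

Lemma is_RInt_C (f : R -> C) (a b : R) (l : C) :
  is_RInt (fun t => fst (f t)) a b (fst l) -> is_RInt (fun t => snd (f t)) a b (snd l) ->
  is_RInt (V := C_R_NormedModule) f a b l.
Proof. intros H1 H2. destruct l. now apply (is_RInt_fct_extend_pair (U := R_NormedModule) (V := R_NormedModule)). Qed.

Lemma is_RInt_fst (f : R -> C) (a b : R) (l : C) :
  is_RInt (V := C_R_NormedModule) f a b l -> is_RInt (fun t => fst (f t)) a b (fst l).
Proof. apply (is_RInt_fct_extend_fst (U := R_NormedModule) (V := R_NormedModule)). Qed.

Lemma is_RInt_snd (f : R -> C) (a b : R) (l : C) :
  is_RInt (V := C_R_NormedModule) f a b l -> is_RInt (fun t => snd (f t)) a b (snd l).
Proof. apply (is_RInt_fct_extend_snd (U := R_NormedModule) (V := R_NormedModule)). Qed.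

Lemma is_RInt_Cmult (c : C) (f : R -> C) (a b : R) (l : C) :
  is_RInt (V := C_R_NormedModule) f a b l ->
  is_RInt (V := C_R_NormedModule) (fun t => c * f t)%C a b (c * l)%C.
Proof.
  intros H. pose proof (is_RInt_fst _ _ _ _ H) as H1. pose proof (is_RInt_snd _ _ _ _ H) as H2.
  apply is_RInt_C; simpl.
  - apply (is_RInt_minus (V := R_NormedModule)); now apply (is_RInt_scal (V := R_NormedModule)).
  - apply (is_RInt_plus (V := R_NormedModule)); now apply (is_RInt_scal (V := R_NormedModule)).
Qed.

Lemma is_RInt_RtoC (f : R -> R) (a b l : R) :
  is_RInt f a b l -> is_RInt (V := C_R_NormedModule) (fun t => RtoC (f t)) a b (RtoC l).
Proof.
  intros H. apply is_RInt_C; simpl; auto.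
  pose proof (is_RInt_const (V := R_NormedModule) a b 0) as H0.
  unfold scal in H0; simpl in H0; unfold mult in H0; simpl in H0.
  now rewrite Rmult_0_r in H0.
Qed.

Lemma is_RInt_Cexp (z : C) (b : R) : z <> RtoC 0 ->
  is_RInt (V := C_R_NormedModule) (fun x => Cexp (- (z * RtoC x)))%C 0 b
    ((RtoC 1 - Cexp (- (z * RtoC b))) / z)%C.
Proof.
  intros Hz.
  assert (H : is_RInt (V := C_R_NormedModule) (fun x => (- / z) * (- z * Cexp (- z * RtoC x)))%C 0 b
     (minus ((- / z) * Cexp (- z * RtoC b))%C ((- / z) * Cexp (- z * RtoC 0))%C)).
  { apply (is_RInt_derive (V := C_R_CompleteNormedModule) (fun x => (- / z) * Cexp (- z * RtoC x))%C).
    - intros x _. apply is_derive_Cexp_lin.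
    - intros x _. apply (continuous_ext (fun x => (- / z * - z) * Cexp (- z * RtoC x))%C).
      + intros t. eq_C. ring.
      + apply (continuous_Cexp_lin (- / z * - z)%C). }
  replace ((RtoC 1 - Cexp (- (z * RtoC b))) / z)%C with
    (minus (G := C_R_NormedModule) ((- / z) * Cexp (- z * RtoC b))%C ((- / z) * Cexp (- z * RtoC 0))%C).
  - eapply is_RInt_ext; [|apply H]. intros x _. eq_C.
    replace (- (z * RtoC x))%C with (- z * RtoC x)%C by ring. field. auto.
  - change (minus (G := C_R_NormedModule)) with Cminus. eq_C.
    replace (- z * RtoC 0)%C with (RtoC 0) by ring. rewrite Cexp_0.
    replace (- (z * RtoC b))%C with (- z * RtoC b)%C by ring. field. auto.
Qed.

Lemma is_RInt_swap_order_C (f : R -> R -> C) (A B : R -> C) (a b c d : R) :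
  (forall x y, continuity_2d_pt (fun u v => fst (f u v)) x y) ->
  (forall x y, continuity_2d_pt (fun u v => snd (f u v)) x y) ->
  (forall x, is_RInt (V := C_R_NormedModule) (f x) c d (A x)) ->
  (forall v, is_RInt (V := C_R_NormedModule) (fun x => f x v) a b (B v)) ->
  exists l, is_RInt (V := C_R_NormedModule) A a b l /\ is_RInt (V := C_R_NormedModule) B c d l.
Proof.
  intros H1 H2 HA HB.
  destruct (is_RInt_swap_order _ (fun x => fst (A x)) (fun x => fst (B x)) a b c d H1)
    as [l1 [HA1 HB1]].
  { intros x. now apply is_RInt_fst. }
  { intros v. apply (is_RInt_fst (fun x => f x v)). auto. }
  destruct (is_RInt_swap_order _ (fun x => snd (A x)) (fun x => snd (B x)) a b c d H2)
    as [l2 [HA2 HB2]].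
  { intros x. now apply is_RInt_snd. }
  { intros v. apply (is_RInt_snd (fun x => f x v)). auto. }
  exists (l1, l2). split; now apply is_RInt_C.
Qed.

(** * Integral representation of the terms and integration in [x] *)

Definition sinc_scaled (k y : R) : R := if Req_EM_T y 0 then k else sin (k * y) / y.

(** Thanks to the value [k] at [y = 0] the representation holds for every [y], so that the
    two-variable integrand stays continuous across [x = PI]. *)
Lemma is_RInt_sinc (k y : R) :
  is_RInt (fun v => k * cos (k * y * v)) 0 1 (sinc_scaled k y).
Proof.
  unfold sinc_scaled. destruct (Req_EM_T y 0) as [->|Hy].
  - apply is_RInt_ext with (fun _ => k).
    + intros v _. rewrite Rmult_0_r, Rmult_0_l, cos_0. eq_R. ring.
    + pose proof (is_RInt_const (V := R_NormedModule) 0 1 k) as H.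
      unfold scal in H; simpl in H; unfold mult in H; simpl in H.
      now rewrite Rminus_0_r, Rmult_1_l in H.
  - replace (sin (k * y) / y) with (minus (sin (k * y * 1) / y) (sin (k * y * 0) / y)).
    + apply (is_RInt_derive (V := R_CompleteNormedModule) (fun v => sin (k * y * v) / y)).
      * intros v _. auto_derive; auto. field; auto.
      * intros v _. apply (ex_derive_continuous (V := R_NormedModule)). auto_derive; auto.
    + unfold minus, plus, opp; simpl. rewrite Rmult_0_r, Rmult_1_r, sin_0. eq_R. field; auto.
Qed.

(* The continuous extension to [x = PI] of [2 x sin (2 n x) / (x^2 - PI^2)]. *)
Definition series_weight (n : nat) (x : R) : R :=
  sinc_scaled (2 * INR n) (x - PI) + sinc_scaled (2 * INR n) (x + PI).

Lemma is_RInt_weight n x :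
  is_RInt (fun v => 4 * INR n * cos (2 * INR n * v * x) * cos (2 * PI * INR n * v)) 0 1
    (series_weight n x).
Proof.
  eapply is_RInt_ext.
  2: apply (is_RInt_plus (V := R_NormedModule) _ _ _ _ _ _
        (is_RInt_sinc (2 * INR n) (x - PI)) (is_RInt_sinc (2 * INR n) (x + PI))).
  intros v _. unfold plus; simpl.
  replace (2 * INR n * (x - PI) * v) with (2 * INR n * v * x - 2 * PI * INR n * v) by ring.
  replace (2 * INR n * (x + PI) * v) with (2 * INR n * v * x + 2 * PI * INR n * v) by ring.
  rewrite cos_minus, cos_plus. eq_R. ring.
Qed.

(* [2 a / (a^2 + v^2)] in partial fractions. *)
Definition poisson2 (a : C) (v : R) : C := (/ (a - Ci * RtoC v) + / (a + Ci * RtoC v))%C.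

(** [poisson2] with the [x]-integration stopped at [b]: each [1 / z] is replaced by [k] times the
    integral of [e^(-k z x)] over [[0, b]]. *)
Definition poisson2_trunc (a : C) (k b v : R) : C :=
  ((RtoC 1 - Cexp (- (RtoC k * (a - Ci * RtoC v) * RtoC b))) / (a - Ci * RtoC v)
   + (RtoC 1 - Cexp (- (RtoC k * (a + Ci * RtoC v) * RtoC b))) / (a + Ci * RtoC v))%C.

Lemma Re_pos_neq_0 (z : C) : 0 < Re z -> z <> RtoC 0.
Proof. intros H E. rewrite E in H. simpl in H. lra. Qed.

Lemma Re_minus_Ci (a : C) v : Re (a - Ci * RtoC v) = Re a.
Proof. destruct a; simpl; ring. Qed.

Lemma Re_plus_Ci (a : C) v : Re (a + Ci * RtoC v) = Re a.
Proof. destruct a; simpl; ring. Qed.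

Lemma is_RInt_term_x (a : C) (k b v : R) : 0 < Re a -> 0 < k ->
  is_RInt (V := C_R_NormedModule)
    (fun x => Cexp (- (RtoC k * a * RtoC x)) * RtoC (2 * k * cos (k * v * x)))%C 0 b
    (poisson2_trunc a k b v).
Proof.
  intros Ha Hk.
  assert (Hk' : RtoC k <> RtoC 0) by (intros E; apply RtoC_inj in E; lra).
  assert (Hm : (a - Ci * RtoC v)%C <> RtoC 0) by (apply Re_pos_neq_0; now rewrite Re_minus_Ci).
  assert (Hp : (a + Ci * RtoC v)%C <> RtoC 0) by (apply Re_pos_neq_0; now rewrite Re_plus_Ci).
  replace (poisson2_trunc a k b v) with (RtoC k *
    (plus (G := C_R_NormedModule)
     ((RtoC 1 - Cexp (- (RtoC k * (a - Ci * RtoC v) * RtoC b))) / (RtoC k * (a - Ci * RtoC v)))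
     ((RtoC 1 - Cexp (- (RtoC k * (a + Ci * RtoC v) * RtoC b))) / (RtoC k * (a + Ci * RtoC v)))))%C.
  2:{ change (plus (G := C_R_NormedModule)) with Cplus. unfold poisson2_trunc. eq_C. field. auto. }
  eapply is_RInt_ext.
  2:{ apply is_RInt_Cmult, (is_RInt_plus (V := C_R_NormedModule));
      apply is_RInt_Cexp; now apply Cmult_neq_0. }
  intros x _. change (plus (G := C_R_NormedModule)) with Cplus. eq_C.
  replace (2 * k * cos (k * v * x)) with (k * (2 * cos (k * v * x))) by ring.
  rewrite RtoC_mult, <- Cexp_Ci_cos.
  replace (- (RtoC k * (a - Ci * RtoC v) * RtoC x))%C with
    (- (RtoC k * a * RtoC x) + Ci * RtoC (k * v * x))%C by (rewrite !RtoC_mult; ring).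
  replace (- (RtoC k * (a + Ci * RtoC v) * RtoC x))%C with
    (- (RtoC k * a * RtoC x) + - (Ci * RtoC (k * v * x)))%C by (rewrite !RtoC_mult; ring).
  rewrite !Cexp_plus. ring.
Qed.

Lemma term_swap (a : C) (n : nat) (b : R) : 0 < Re a -> (1 <= n)%nat ->
  exists l,
    is_RInt (V := C_R_NormedModule)
      (fun x => Cexp (- (RtoC (2 * INR n) * a * RtoC x)) * RtoC (series_weight n x))%C 0 b l /\
    is_RInt (V := C_R_NormedModule)
      (fun v => RtoC (cos (2 * PI * INR n * v)) * poisson2_trunc a (2 * INR n) b v)%C 0 1 l.
Proof.
  intros Ha Hn. assert (Hk : 0 < INR n) by (apply lt_0_INR; lia).
  apply (is_RInt_swap_order_C (fun x v => Cexp (- (RtoC (2 * INR n) * a * RtoC x)) *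
     RtoC (4 * INR n * cos (2 * INR n * v * x) * cos (2 * PI * INR n * v)))%C).
  - intros x y. destruct a as [a1 a2]. simpl.
    repeat first [ apply continuity_2d_pt_plus | apply continuity_2d_pt_minus
      | apply continuity_2d_pt_mult | apply continuity_2d_pt_opp
      | apply continuity_2d_pt_const | apply continuity_2d_pt_id1 | apply continuity_2d_pt_id2
      | apply (continuity_1d_2d_pt_comp exp); [apply derivable_continuous, derivable_exp|]
      | apply (continuity_1d_2d_pt_comp cos); [apply continuity_cos|]
      | apply (continuity_1d_2d_pt_comp sin); [apply continuity_sin|] ].
  - intros x y. destruct a as [a1 a2]. simpl.
    repeat first [ apply continuity_2d_pt_plus | apply continuity_2d_pt_minus
      | apply continuity_2d_pt_mult | apply continuity_2d_pt_opp
      | apply continuity_2d_pt_const | apply continuity_2d_pt_id1 | apply continuity_2d_pt_id2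
      | apply (continuity_1d_2d_pt_comp exp); [apply derivable_continuous, derivable_exp|]
      | apply (continuity_1d_2d_pt_comp cos); [apply continuity_cos|]
      | apply (continuity_1d_2d_pt_comp sin); [apply continuity_sin|] ].
  - intros x. apply is_RInt_Cmult, is_RInt_RtoC, is_RInt_weight.
  - intros v. eapply is_RInt_ext.
    2:{ apply is_RInt_Cmult, (is_RInt_term_x a (2 * INR n) b v); lra. }
    intros x _. eq_C.
    replace (4 * INR n * cos (2 * INR n * v * x) * cos (2 * PI * INR n * v)) with
      (cos (2 * PI * INR n * v) * (2 * (2 * INR n) * cos (2 * INR n * v * x))) by ring.
    rewrite (RtoC_mult (cos (2 * PI * INR n * v))). ring.
Qed.

Lemma Cmod_inv_Re (z : C) : 0 < Re z -> Cmod (/ z) <= / Re z.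
Proof.
  intros H. rewrite Cmod_inv by now apply Re_pos_neq_0.
  apply Rinv_le_contravar; auto.
  eapply Rle_trans; [|apply (Rmax_Cmod z)].
  eapply Rle_trans; [|apply Rmax_l]. apply Rle_abs.
Qed.

(** The points [a - i v] and [a + i v] all have real part [Re a], so the error is uniform in [v] and
    survives the integration over [[0, 1]]. *)
Lemma poisson2_trunc_diff (a : C) (k b v : R) : 0 < Re a ->
  Cmod (poisson2_trunc a k b v - poisson2 a v) <= 2 * exp (- (k * Re a * b)) / Re a.
Proof.
  intros Ha.
  assert (Hm : (a - Ci * RtoC v)%C <> RtoC 0) by (apply Re_pos_neq_0; now rewrite Re_minus_Ci).
  assert (Hp : (a + Ci * RtoC v)%C <> RtoC 0) by (apply Re_pos_neq_0; now rewrite Re_plus_Ci).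
  replace (poisson2_trunc a k b v - poisson2 a v)%C with
    (- (Cexp (- (RtoC k * (a - Ci * RtoC v) * RtoC b)) * / (a - Ci * RtoC v)
     + Cexp (- (RtoC k * (a + Ci * RtoC v) * RtoC b)) * / (a + Ci * RtoC v)))%C
    by (unfold poisson2_trunc, poisson2; field; auto).
  rewrite Cmod_opp. eapply Rle_trans; [apply Cmod_triangle|].
  rewrite !Cmod_mult, !Cmod_Cexp.
  replace (Re (- (RtoC k * (a - Ci * RtoC v) * RtoC b))) with (- (k * Re a * b))
    by (destruct a; simpl; ring).
  replace (Re (- (RtoC k * (a + Ci * RtoC v) * RtoC b))) with (- (k * Re a * b))
    by (destruct a; simpl; ring).
  pose proof (Cmod_inv_Re (a - Ci * RtoC v)%C) as H1. rewrite Re_minus_Ci in H1.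
  pose proof (Cmod_inv_Re (a + Ci * RtoC v)%C) as H2. rewrite Re_plus_Ci in H2.
  specialize (H1 Ha). specialize (H2 Ha).
  pose proof (exp_pos (- (k * Re a * b))). unfold Rdiv. nra.
Qed.

Lemma term_integral (a : C) (n : nat) (b : R) (L : C) : 0 < Re a -> (1 <= n)%nat ->
  is_RInt (V := C_R_NormedModule)
      (fun v => RtoC (cos (2 * PI * INR n * v)) * poisson2 a v)%C 0 1 L ->
  exists l,
    is_RInt (V := C_R_NormedModule)
      (fun x => Cexp (- (RtoC (2 * INR n) * a * RtoC x)) * RtoC (series_weight n x))%C 0 b l /\
    Cmod (l - L) <= 2 * exp (- (2 * INR n * Re a * b)) / Re a.
Proof.
  intros Ha Hn HL. destruct (term_swap a n b Ha Hn) as [l [Hl1 Hl2]].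
  exists l; split; auto.
  pose proof (is_RInt_minus (V := C_R_NormedModule) _ _ _ _ _ _ Hl2 HL) as HD.
  assert (HB : norm (V := C_R_NormedModule) (minus (G := C_R_NormedModule) l L)
     <= (1 - 0) * (2 * exp (- (2 * INR n * Re a * b)) / Re a)).
  { apply (norm_RInt_le_const (V := C_R_NormedModule)) with (3 := HD); [lra|].
    intros v _. rewrite norm_Cmod. change (minus (G := C_R_NormedModule)) with Cminus. cbv beta.
    replace (RtoC (cos (2 * PI * INR n * v)) * poisson2_trunc a (2 * INR n) b v -
      RtoC (cos (2 * PI * INR n * v)) * poisson2 a v)%C with
      (RtoC (cos (2 * PI * INR n * v)) * (poisson2_trunc a (2 * INR n) b v - poisson2 a v))%C by ring.
    rewrite Cmod_mult, Cmod_R.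
    pose proof (poisson2_trunc_diff a (2 * INR n) b v Ha).
    assert (Rabs (cos (2 * PI * INR n * v)) <= 1) by (apply Rabs_le, COS_bound).
    pose proof (Rabs_pos (cos (2 * PI * INR n * v))).
    pose proof (Cmod_ge_0 (poisson2_trunc a (2 * INR n) b v - poisson2 a v)).
    nra. }
  rewrite norm_Cmod in HB. change (minus (G := C_R_NormedModule)) with Cminus in HB. lra.
Qed.

(** * The value of the limit *)

Lemma sq_sum_pos (x t : R) : 0 < x -> 0 < x * x + t * t.
Proof. intros Hx. pose proof (Rle_0_sqr t). unfold Rsqr in *. nra. Qed.

Lemma Clog_polar (t th : R) : 0 < t -> - PI < th < PI ->
  Clog (t * cos th, t * sin th) = (ln t, th).
Proof.
  intros Ht Hth.
  assert (Hm : Cmod (t * cos th, t * sin th) = t).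
  { unfold Cmod; simpl. transitivity (sqrt (Rsqr t)).
    - f_equal. pose proof (sin2_cos2 th) as H. unfold Rsqr in *.
      transitivity (t * t * (sin th * sin th + cos th * cos th)); [ring|rewrite H; ring].
    - apply sqrt_Rsqr; lra. }
  unfold Clog, Carg. rewrite Hm. f_equal. simpl.
  replace (t * cos th / t) with (cos th) by (field; lra).
  destruct (Rle_dec 0 th) as [h|h].
  - assert (0 <= sin th) by (apply sin_ge_0; lra).
    destruct (Rle_dec 0 (t * sin th)) as [h'|h']; [|exfalso; nra].
    apply acos_cos; lra.
  - assert (Hs : 0 < sin (- th)) by (apply sin_gt_0; lra). rewrite sin_neg in Hs.
    destruct (Rle_dec 0 (t * sin th)) as [h'|h']; [exfalso; nra|].
    rewrite <- (cos_neg th), acos_cos; lra.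
Qed.

Lemma polar_atan (x y : R) : 0 < x ->
  (x, y) = (sqrt (x * x + y * y) * cos (atan (y / x)), sqrt (x * x + y * y) * sin (atan (y / x))).
Proof.
  intros Hx. rewrite cos_atan, sin_atan.
  assert (Hp : 0 < x * x + y * y) by nra.
  replace (1 + Rsqr (y / x)) with ((x * x + y * y) / Rsqr x) by (unfold Rsqr; field; lra).
  rewrite sqrt_div by (unfold Rsqr; nra). rewrite sqrt_Rsqr by lra.
  assert (0 < sqrt (x * x + y * y)) by now apply sqrt_lt_R0.
  f_equal; field; split; lra.
Qed.

Lemma ln_sqrt_half (x : R) : 0 < x -> ln (sqrt x) = ln x / 2.
Proof.
  intros Hx. assert (0 < sqrt x) by now apply sqrt_lt_R0.
  rewrite <- (sqrt_sqrt x) at 2 by lra. rewrite ln_mult; auto. field.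
Qed.

Lemma Cdiv_unique (z w u : C) : u <> RtoC 0 -> (z * u)%C = w -> z = (w / u)%C.
Proof. intros Hu <-. field. exact Hu. Qed.

(** Both points lie in the right half-plane, so their arguments are [atan] values in
    [(-PI/2, PI/2)]. The difference stays in [(-PI, PI)], and the logarithm of the quotient needs no
    multiple of [2 PI]. *)
Lemma Clog_div (x y s : R) : 0 < x ->
  Clog ((x, s) / (x, y))%C =
  ((ln (x * x + s * s) - ln (x * x + y * y)) / 2, atan (s / x) - atan (y / x)).
Proof.
  intros Hx.
  assert (H1 : 0 < x * x + s * s) by nra. assert (H2 : 0 < x * x + y * y) by nra.
  assert (H1' := sqrt_lt_R0 _ H1). assert (H2' := sqrt_lt_R0 _ H2).
  assert (Hxy : (x, y) <> RtoC 0) by (apply Re_pos_neq_0; auto).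
  set (r := sqrt (x * x + s * s)) in *. set (q := sqrt (x * x + y * y)) in *.
  set (th := atan (s / x) - atan (y / x)).
  replace ((x, s) / (x, y))%C with (r / q * cos th, r / q * sin th).
  - rewrite Clog_polar.
    + f_equal. unfold r, q. unfold Rdiv at 1.
      rewrite ln_mult, ln_Rinv, !ln_sqrt_half; auto; [field|].
      now apply Rinv_0_lt_compat.
    + now apply Rdiv_lt_0_compat.
    + unfold th. pose proof (atan_bound (s / x)). pose proof (atan_bound (y / x)). lra.
  - apply (Cdiv_unique (r / q * cos th, r / q * sin th) (x, s) (x, y) Hxy).
    rewrite (polar_atan x y Hx) at 1. rewrite (polar_atan x s Hx). fold r q.
    replace (atan (s / x)) with (th + atan (y / x)) by (unfold th; ring).
    rewrite cos_plus, sin_plus. unfold Cmult; simpl. f_equal; field; lra.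
Qed.

(** Writing [1 - i/a = (a - i) / a] and [1 + i/a = (a + i) / a], the contributions of the common
    denominator [a] to modulus and argument cancel in the difference of logarithms. *)
Lemma Catan_inv (a : C) : 0 < Re a ->
  let (x, y) := a in
  Catan (RtoC 1 / a)%C =
  ((atan ((y + 1) / x) - atan ((y - 1) / x)) / 2,
   (ln (x * x + (y - 1) * (y - 1)) - ln (x * x + (y + 1) * (y + 1))) / 4).
Proof.
  intros Ha. destruct a as [x y]. simpl in Ha.
  assert (Hxy : (x, y) <> RtoC 0) by (apply Re_pos_neq_0; auto).
  unfold Catan.
  replace (RtoC 1 - Ci * (RtoC 1 / (x, y)))%C with (Cdiv (x, y - 1) (x, y)).
  2:{ symmetry. apply Cdiv_unique; auto.
      transitivity ((x, y) - Ci)%C; [field; auto|].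
      unfold Ci, Cminus, Cplus, Copp; simpl; f_equal; ring. }
  replace (RtoC 1 + Ci * (RtoC 1 / (x, y)))%C with (Cdiv (x, y + 1) (x, y)).
  2:{ symmetry. apply Cdiv_unique; auto.
      transitivity ((x, y) + Ci)%C; [field; auto|].
      unfold Ci, Cminus, Cplus, Copp; simpl; f_equal; ring. }
  rewrite !Clog_div by auto.
  unfold Cdiv, Cmult, Cminus, Cplus, Copp, Cinv, Ci, RtoC; simpl. f_equal; field.
Qed.

(** Together with [poisson_im], the real and imaginary parts of [h v = a / (a^2 + v^2)] for
    [a = x + i y], from the partial fractions. *)
Definition poisson_re (x y v : R) : R :=
  (x / (x * x + (y - v) * (y - v)) + x / (x * x + (y + v) * (y + v))) / 2.

Definition poisson_im (x y v : R) : R :=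
  - ((y - v) / (x * x + (y - v) * (y - v)) + (y + v) / (x * x + (y + v) * (y + v))) / 2.

Lemma poisson2_parts (x y v : R) : 0 < x ->
  poisson2 (x, y) v = (2 * poisson_re x y v, 2 * poisson_im x y v).
Proof.
  intros Hx. unfold poisson2, poisson_re, poisson_im.
  pose proof (sq_sum_pos x (y - v) Hx).
  pose proof (sq_sum_pos x (y + v) Hx).
  unfold Cmult, Cminus, Cplus, Copp, Cinv, Ci, RtoC; simpl.
  f_equal; field; repeat split; nra.
Qed.

Definition poisson_re' (x y v : R) : R :=
  (x * (2 * (y - v)) / Rsqr (x * x + (y - v) * (y - v))
   - x * (2 * (y + v)) / Rsqr (x * x + (y + v) * (y + v))) / 2.

Definition poisson_im' (x y v : R) : R :=
  - ((- (x * x + (y - v) * (y - v)) + 2 * ((y - v) * (y - v))) / Rsqr (x * x + (y - v) * (y - v))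
   + ((x * x + (y + v) * (y + v)) - 2 * ((y + v) * (y + v))) / Rsqr (x * x + (y + v) * (y + v))) / 2.

Lemma is_derive_poisson_re x y v : 0 < x -> is_derive (poisson_re x y) v (poisson_re' x y v).
Proof.
  intros Hx.
  pose proof (sq_sum_pos x (y - v) Hx).
  pose proof (sq_sum_pos x (y + v) Hx).
  unfold poisson_re. auto_derive; [repeat split; nra|].
  unfold poisson_re', Rsqr. field. repeat split; nra.
Qed.

Lemma is_derive_poisson_im x y v : 0 < x -> is_derive (poisson_im x y) v (poisson_im' x y v).
Proof.
  intros Hx.
  pose proof (sq_sum_pos x (y - v) Hx).
  pose proof (sq_sum_pos x (y + v) Hx).
  unfold poisson_im. auto_derive; [repeat split; nra|].
  unfold poisson_im', Rsqr. field. repeat split; nra.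
Qed.

Lemma continuous_poisson_re' x y v : 0 < x -> continuous (poisson_re' x y) v.
Proof.
  intros Hx.
  pose proof (sq_sum_pos x (y - v) Hx).
  pose proof (sq_sum_pos x (y + v) Hx).
  apply (ex_derive_continuous (V := R_NormedModule)). unfold poisson_re', Rsqr.
  auto_derive. repeat split; apply Rmult_integral_contrapositive_currified; nra.
Qed.

Lemma continuous_poisson_im' x y v : 0 < x -> continuous (poisson_im' x y) v.
Proof.
  intros Hx.
  pose proof (sq_sum_pos x (y - v) Hx).
  pose proof (sq_sum_pos x (y + v) Hx).
  apply (ex_derive_continuous (V := R_NormedModule)). unfold poisson_im', Rsqr.
  auto_derive. repeat split; apply Rmult_integral_contrapositive_currified; nra.
Qed.

(** The right-hand side is the real part of [Catan (1 / a)] in [Catan_inv]. The primitive is odd in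
    [v], so the lower limit contributes nothing to it. *)
Lemma RInt_poisson_re x y : 0 < x ->
  RInt (poisson_re x y) 0 1 = (atan ((y + 1) / x) - atan ((y - 1) / x)) / 2.
Proof.
  intros Hx. apply is_RInt_unique.
  replace ((atan ((y + 1) / x) - atan ((y - 1) / x)) / 2) with
    (minus ((atan ((y + 1) / x) - atan ((y - 1) / x)) / 2)
           ((atan ((y + 0) / x) - atan ((y - 0) / x)) / 2)).
  - apply (is_RInt_derive (V := R_CompleteNormedModule)
      (fun v => (atan ((y + v) / x) - atan ((y - v) / x)) / 2)).
    + intros v _.
      pose proof (sq_sum_pos x (y - v) Hx).
      pose proof (sq_sum_pos x (y + v) Hx).
      unfold poisson_re. auto_derive; auto. field. repeat split; nra.
    + intros v _. apply (ex_derive_continuous (V := R_NormedModule)).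
      eexists; now apply is_derive_poisson_re.
  - unfold minus, plus, opp; simpl. rewrite Rplus_0_r, Rminus_0_r. eq_R. lra.
Qed.

Lemma RInt_poisson_im x y : 0 < x ->
  RInt (poisson_im x y) 0 1 =
    (ln (x * x + (y - 1) * (y - 1)) - ln (x * x + (y + 1) * (y + 1))) / 4.
Proof.
  intros Hx. apply is_RInt_unique.
  replace ((ln (x * x + (y - 1) * (y - 1)) - ln (x * x + (y + 1) * (y + 1))) / 4) with
    (minus ((ln (x * x + (y - 1) * (y - 1)) - ln (x * x + (y + 1) * (y + 1))) / 4)
      ((ln (x * x + (y - 0) * (y - 0)) - ln (x * x + (y + 0) * (y + 0))) / 4)).
  - apply (is_RInt_derive (V := R_CompleteNormedModule)
      (fun v => (ln (x * x + (y - v) * (y - v)) - ln (x * x + (y + v) * (y + v))) / 4)).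
    + intros v _.
      pose proof (sq_sum_pos x (y - v) Hx).
      pose proof (sq_sum_pos x (y + v) Hx).
      unfold poisson_im. auto_derive; [repeat split; nra|]. field. repeat split; nra.
    + intros v _. apply (ex_derive_continuous (V := R_NormedModule)).
      eexists; now apply is_derive_poisson_im.
  - unfold minus, plus, opp; simpl. rewrite Rplus_0_r, Rminus_0_r. eq_R. lra.
Qed.

Definition fourier_coeff (a : C) (n : nat) : C :=
  (RInt (fun v => 2 * cos (2 * PI * INR n * v) * poisson_re (Re a) (Im a) v) 0 1,
   RInt (fun v => 2 * cos (2 * PI * INR n * v) * poisson_im (Re a) (Im a) v) 0 1).

Lemma is_RInt_fourier_coeff (a : C) (n : nat) : 0 < Re a ->
  is_RInt (V := C_R_NormedModule)
    (fun v => RtoC (cos (2 * PI * INR n * v)) * poisson2 a v)%C 0 1 (fourier_coeff a n).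
Proof.
  destruct a as [x y]. simpl. intros Hx.
  assert (Hc : forall f v, ex_derive f v -> continuous (fun v => 2 * cos (2 * PI * INR n * v) * f v) v).
  { intros f v Hf. apply @continuous_mult.
    - apply (ex_derive_continuous (V := R_NormedModule)). auto_derive; auto.
    - now apply (ex_derive_continuous (V := R_NormedModule)). }
  apply is_RInt_C; unfold fourier_coeff; cbn [fst snd Re Im].
  - eapply is_RInt_ext.
    2:{ apply (RInt_correct (V := R_CompleteNormedModule)), (ex_RInt_continuous (V := R_CompleteNormedModule)).
        intros v _. apply Hc. eexists; now apply is_derive_poisson_re. }
    intros v _. rewrite poisson2_parts by auto. simpl. eq_R. ring.
  - eapply is_RInt_ext.
    2:{ apply (RInt_correct (V := R_CompleteNormedModule)), (ex_RInt_continuous (V := R_CompleteNormedModule)).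
        intros v _. apply Hc. eexists; now apply is_derive_poisson_im. }
    intros v _. rewrite poisson2_parts by auto. simpl. eq_R. ring.
Qed.

Definition limit_value (a : C) : C :=
  (RtoC 1 / (RtoC 2 * a) * ((RtoC 1 + RtoC 2 * (a * a)) / (RtoC 1 + a * a))
     - Catan (RtoC 1 / a))%C.

(** The rational part of the answer is [(h 0 + h 1) / 2]; the factor 4 also accounts for [poisson2]
    being [2 h]. *)
Lemma poisson2_endpoints (a : C) : 0 < Re a ->
  (RtoC 1 / (RtoC 2 * a) * ((RtoC 1 + RtoC 2 * (a * a)) / (RtoC 1 + a * a)))%C
    = ((poisson2 a 0 + poisson2 a 1) * / RtoC 4)%C.
Proof.
  intros Ha. unfold poisson2.
  assert (H0 : a <> RtoC 0) by now apply Re_pos_neq_0.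
  assert (Hm : (a - Ci)%C <> RtoC 0) by (apply Re_pos_neq_0; destruct a; simpl in *; lra).
  assert (Hp : (a + Ci)%C <> RtoC 0) by (apply Re_pos_neq_0; destruct a; simpl in *; lra).
  assert (Hi : (Ci * Ci)%C = (- RtoC 1)%C) by (unfold Ci, Cmult, Copp, RtoC; simpl; f_equal; ring).
  (* For [field] the unit [Ci] is a mere atom; factoring [1 + a^2] beforehand removes every use of
     [i^2 = -1]. *)
  assert (E1 : (RtoC 1 + a * a)%C = ((a - Ci) * (a + Ci))%C).
  { replace ((a - Ci) * (a + Ci))%C with (a * a - Ci * Ci)%C by ring. rewrite Hi. ring. }
  rewrite E1.
  replace (RtoC 1 + RtoC 2 * (a * a))%C with (a * a + (a - Ci) * (a + Ci))%C by (rewrite <- E1; ring).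
  replace (a - Ci * RtoC 0)%C with a by ring. replace (a + Ci * RtoC 0)%C with a by ring.
  replace (a - Ci * RtoC 1)%C with (a - Ci)%C by ring. replace (a + Ci * RtoC 1)%C with (a + Ci)%C by ring.
  replace (RtoC 4) with (RtoC 2 * RtoC 2)%C by (rewrite <- RtoC_mult; f_equal; ring).
  field. repeat split; auto.
Qed.

Lemma limit_value_parts (x y : R) : 0 < x ->
  limit_value (x, y) =
  ((poisson_re x y 0 + poisson_re x y 1) / 2 - RInt (poisson_re x y) 0 1,
   (poisson_im x y 0 + poisson_im x y 1) / 2 - RInt (poisson_im x y) 0 1).
Proof.
  intros Hx. unfold limit_value. rewrite (Catan_inv (x, y) Hx).
  rewrite RInt_poisson_re, RInt_poisson_im by auto.
  rewrite (poisson2_endpoints (x, y) Hx), !poisson2_parts by auto.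
  unfold Cminus, Cplus, Cmult, Copp, Cinv, RtoC; simpl. f_equal; field.
Qed.

Lemma fourier_coeff_sum (a : C) (eps : R) : 0 < Re a -> 0 < eps ->
  exists N0, forall N, (N0 <= N)%nat ->
    Cmod (sum_n_m (G := C_AbelianMonoid) (fourier_coeff a) 1 N - limit_value a) < eps.
Proof.
  destruct a as [x y]. simpl. intros Hx Heps.
  pose proof (fourier_endpoint_sum (poisson_re x y) (poisson_re' x y)
    (fun v => is_derive_poisson_re x y v Hx) (fun v => continuous_poisson_re' x y v Hx)) as H1.
  pose proof (fourier_endpoint_sum (poisson_im x y) (poisson_im' x y)
    (fun v => is_derive_poisson_im x y v Hx) (fun v => continuous_poisson_im' x y v Hx)) as H2.
  apply is_lim_seq_spec in H1. apply is_lim_seq_spec in H2.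
  assert (He : 0 < eps / 2) by lra.
  destruct (H1 (mkposreal _ He)) as [N1 HN1]. destruct (H2 (mkposreal _ He)) as [N2 HN2].
  exists (max N1 N2). intros N HN.
  specialize (HN1 N ltac:(lia)). specialize (HN2 N ltac:(lia)).
  rewrite limit_value_parts by auto. simpl pos in *.
  assert (Hs : sum_n_m (G := C_AbelianMonoid) (fourier_coeff (x, y)) 1 N =
    (sum_n_m (fun n => RInt (fun v => 2 * cos (2 * PI * INR n * v) * poisson_re x y v) 0 1) 1 N,
     sum_n_m (fun n => RInt (fun v => 2 * cos (2 * PI * INR n * v) * poisson_im x y v) 0 1) 1 N)).
  { clear. induction N as [|N IH].
    - now rewrite !sum_1_0.
    - rewrite !sum_1_S, IH. reflexivity. }
  rewrite Hs. clear Hs.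
  set (s1 := sum_n_m _ _ _) in *. set (s2 := sum_n_m _ _ _) in *.
  (* The modulus is at most [sqrt 2] times the larger component, and [sqrt 2 < 2] matches the
     tolerance [eps / 2] per component. *)
  eapply Rle_lt_trans; [apply Cmod_2Rmax|].
  apply Rle_lt_trans with (sqrt 2 * (eps / 2)).
  - apply Rmult_le_compat_l; [apply sqrt_pos|]. simpl. apply Rmax_lub; left; auto.
  - assert (sqrt 2 < 2). { rewrite <- (sqrt_square 2) at 2 by lra. apply sqrt_lt_1; lra. }
    nra.
Qed.

(** * The remainder of the series *)

Definition exp_lin (z : C) (x : R) : C := Cexp (- (z * RtoC x)).

Lemma exp_lin_plus z w x : exp_lin (z + w) x = (exp_lin z x * exp_lin w x)%C.
Proof. unfold exp_lin. rewrite <- Cexp_plus. f_equal. ring. Qed.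

Lemma Cmod_exp_lin z x : Cmod (exp_lin z x) = exp (- (Re z * x)).
Proof. unfold exp_lin. rewrite Cmod_Cexp. f_equal. destruct z; simpl; ring. Qed.

Lemma exp_lin_Ci (x : R) :
  exp_lin (- (RtoC 2 * Ci)) x = (RtoC (cos (2 * x)) + Ci * RtoC (sin (2 * x)))%C.
Proof.
  unfold exp_lin, Cexp, Ci, Cmult, Copp, Cplus, RtoC; simpl.
  replace (- (- (2 * 0 - 0 * 1) * x - - (2 * 1 + 0 * 0) * 0)) with 0 by ring.
  replace (- (- (2 * 0 - 0 * 1) * 0 + - (2 * 1 + 0 * 0) * x)) with (2 * x) by ring.
  rewrite exp_0. f_equal; ring.
Qed.

Lemma exp_lin_Ci_conj (x : R) :
  exp_lin (RtoC 2 * Ci) x = (RtoC (cos (2 * x)) - Ci * RtoC (sin (2 * x)))%C.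
Proof.
  unfold exp_lin, Cexp, Ci, Cmult, Copp, Cminus, Cplus, RtoC; simpl.
  replace (- ((2 * 0 - 0 * 1) * x - (2 * 1 + 0 * 0) * 0)) with (- 0) by ring.
  replace (- ((2 * 0 - 0 * 1) * 0 + (2 * 1 + 0 * 0) * x)) with (- (2 * x)) by ring.
  rewrite Ropp_0, exp_0, sin_neg, cos_neg. f_equal; ring.
Qed.

Lemma Ci_sqr : (Ci * Ci)%C = (- RtoC 1)%C.
Proof. unfold Ci, Cmult, Copp, RtoC; simpl; f_equal; ring. Qed.

Lemma sin2_cos2_C (x : R) :
  (RtoC (sin x) * RtoC (sin x) + RtoC (cos x) * RtoC (cos x))%C = RtoC 1.
Proof. rewrite <- !RtoC_mult, <- RtoC_plus. f_equal. apply sin2_cos2. Qed.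

(* The nome [e^(-2 a x)] of the expansion, and its products with [e^(2 i x)] and [e^(-2 i x)]. *)
Definition nome (a : C) (x : R) : C := exp_lin (RtoC 2 * a) x.
Definition w_minus (a : C) (x : R) : C := exp_lin (RtoC 2 * (a - Ci)) x.
Definition w_plus (a : C) (x : R) : C := exp_lin (RtoC 2 * (a + Ci)) x.

Lemma w_minus_eq a x : w_minus a x = (nome a x * (RtoC (cos (2 * x)) + Ci * RtoC (sin (2 * x))))%C.
Proof.
  rewrite <- exp_lin_Ci. unfold w_minus, nome. rewrite <- exp_lin_plus. f_equal. ring.
Qed.

Lemma w_plus_eq a x : w_plus a x = (nome a x * (RtoC (cos (2 * x)) - Ci * RtoC (sin (2 * x))))%C.
Proof.
  rewrite <- exp_lin_Ci_conj. unfold w_plus, nome. rewrite <- exp_lin_plus. f_equal. ring.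
Qed.

(** The denominator [2 q (cosh 2ax - cos 2x)], in factored form. Both [w_minus] and [w_plus] have
    modulus [e^(-2 Re a x)], which shows that it has no zero for [x > 0]; each factor has a simple
    zero at [x = 0]. *)
Definition kernel_den (a : C) (x : R) : C := ((RtoC 1 - w_minus a x) * (RtoC 1 - w_plus a x))%C.

Lemma den_eq a x :
  kernel_den a x = (RtoC 1 - RtoC 2 * nome a x * RtoC (cos (2 * x)) + nome a x * nome a x)%C.
Proof.
  unfold kernel_den. rewrite w_minus_eq, w_plus_eq.
  pose proof (sin2_cos2_C (2 * x)) as H. set (s := RtoC (sin (2 * x))) in *.
  set (c := RtoC (cos (2 * x))) in *.
  transitivity (RtoC 1 - RtoC 2 * nome a x * c + nome a x * nome a x * (c * c - (Ci * Ci) * (s * s)))%C; [ring|].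
  rewrite Ci_sqr. replace (c * c - - RtoC 1 * (s * s))%C with (s * s + c * c)%C by ring.
  rewrite H. ring.
Qed.

Lemma den_cosh a x :
  kernel_den a x = (RtoC 2 * nome a x * (Ccosh (RtoC 2 * a * RtoC x) - RtoC (cos (2 * x))))%C.
Proof.
  rewrite den_eq. unfold Ccosh.
  assert (H : (nome a x * Cexp (RtoC 2 * a * RtoC x))%C = RtoC 1).
  { unfold nome, exp_lin. rewrite <- Cexp_plus, <- Cexp_0. f_equal. ring. }
  change (Cexp (- (RtoC 2 * a * RtoC x))) with (nome a x).
  rewrite <- H. field.
Qed.

Lemma Cmod_w_minus a x : Cmod (w_minus a x) = exp (- (2 * Re a * x)).
Proof. unfold w_minus. rewrite Cmod_exp_lin. do 2 f_equal. destruct a; simpl; ring. Qed.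

Lemma Cmod_w_plus a x : Cmod (w_plus a x) = exp (- (2 * Re a * x)).
Proof. unfold w_plus. rewrite Cmod_exp_lin. do 2 f_equal. destruct a; simpl; ring. Qed.

Lemma Cmod_nome a x : Cmod (nome a x) = exp (- (2 * Re a * x)).
Proof. unfold nome. rewrite Cmod_exp_lin. do 2 f_equal. destruct a; simpl; ring. Qed.

Lemma Cmod_1_minus (z : C) : 1 - Cmod z <= Cmod (RtoC 1 - z).
Proof.
  pose proof (Cmod_triangle (RtoC 1 - z) z) as H.
  replace (RtoC 1 - z + z)%C with (RtoC 1) in H by ring. rewrite Cmod_1 in H. lra.
Qed.

Lemma exp_gap (a : C) x : 0 < Re a -> 0 < x -> 0 < 1 - exp (- (2 * Re a * x)).
Proof. intros Ha Hx. rewrite <- exp_0. apply Rlt_0_minus, exp_increasing. nra. Qed.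

Lemma one_minus_w_minus_neq_0 (a : C) x : 0 < Re a -> 0 < x -> (RtoC 1 - w_minus a x)%C <> RtoC 0.
Proof.
  intros Ha Hx. apply Cmod_gt_0. eapply Rlt_le_trans; [|apply Cmod_1_minus].
  rewrite Cmod_w_minus. now apply exp_gap.
Qed.

Lemma one_minus_w_plus_neq_0 (a : C) x : 0 < Re a -> 0 < x -> (RtoC 1 - w_plus a x)%C <> RtoC 0.
Proof.
  intros Ha Hx. apply Cmod_gt_0. eapply Rlt_le_trans; [|apply Cmod_1_minus].
  rewrite Cmod_w_plus. now apply exp_gap.
Qed.

Lemma integrand_den (a : C) x : 0 < Re a -> 0 < x ->
  integrand a x =
  (RtoC (sin (2 * x)) * (RtoC 2 * nome a x) / kernel_den a x * (RtoC x / RtoC (x ^ 2 - PI ^ 2)))%C.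
Proof.
  intros Ha Hx. unfold integrand. f_equal.
  assert (Hd : kernel_den a x <> RtoC 0).
  { apply Cmult_neq_0; [now apply one_minus_w_minus_neq_0|now apply one_minus_w_plus_neq_0]. }
  rewrite den_cosh in *.
  assert (Hq : nome a x <> RtoC 0) by apply Cexp_neq_0.
  assert (Hc : (Ccosh (RtoC 2 * a * RtoC x) - RtoC (cos (2 * x)))%C <> RtoC 0).
  { intros E. apply Hd. rewrite E. ring. }
  field. auto.
Qed.

Definition nome_pow (a : C) (n : nat) (x : R) : C := Cexp (- (RtoC (2 * INR n) * a * RtoC x)).

Lemma nome_pow_S a n x : nome_pow a (S n) x = (nome a x * nome_pow a n x)%C.
Proof.
  unfold nome_pow, nome, exp_lin. rewrite <- Cexp_plus. f_equal.
  rewrite S_INR, Rmult_plus_distr_l, RtoC_plus, Rmult_1_r. ring.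
Qed.

Lemma Cmod_nome_pow a n x : Cmod (nome_pow a n x) = exp (- (2 * INR n * Re a * x)).
Proof. unfold nome_pow. rewrite Cmod_Cexp. f_equal. destruct a; simpl; ring. Qed.

(** The tail of the geometric series contains [sin ((2N + 2) x) - q sin (2N x)]. It is expanded so
    that each summand carries [sin 2x] or [sin 2Nx], whose zeros at [0] and [PI] are needed against
    the weight. *)
Lemma geometric_sine_sum a N x :
  (RtoC (sin (2 * x)) * nome a x - kernel_den a x *
    sum_n_m (G := C_AbelianMonoid) (fun n => nome_pow a n x * RtoC (sin (2 * INR n * x)))%C 1 N)%C =
  (nome a x * nome_pow a N x * (RtoC (cos (2 * INR N * x)) * RtoC (sin (2 * x))
     + RtoC (sin (2 * INR N * x)) * (RtoC (cos (2 * x)) - nome a x)))%C.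
Proof.
  rewrite den_eq.
  induction N as [|N IH].
  - rewrite sum_1_0. change (zero (G := C_AbelianMonoid)) with (RtoC 0).
    simpl INR. replace (2 * 0 * x) with 0 by ring. rewrite cos_0, sin_0.
    replace (nome_pow a 0 x) with (RtoC 1); [ring|].
    unfold nome_pow. simpl INR. rewrite Rmult_0_r, <- Cexp_0. f_equal. ring.
  - rewrite sum_1_S. change (plus (G := C_AbelianMonoid)) with Cplus.
    set (S := sum_n_m _ _ _) in *.
    rewrite Cmult_plus_distr_l, nome_pow_S.
    replace (2 * INR (Datatypes.S N) * x) with (2 * INR N * x + 2 * x) by (rewrite S_INR; ring).
    rewrite cos_plus, sin_plus, RtoC_plus, RtoC_minus, !RtoC_mult.
    pose proof (sin2_cos2_C (2 * x)) as H.
    set (c := RtoC (cos (2 * x))) in *. set (s := RtoC (sin (2 * x))) in *.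
    set (cN := RtoC (cos (2 * INR N * x))) in *. set (sN := RtoC (sin (2 * INR N * x))) in *.
    set (E := nome_pow a N x) in *. set (k := nome a x) in *.
    transitivity (s * k - (RtoC 1 - RtoC 2 * k * c + k * k) * S
      - (RtoC 1 - RtoC 2 * k * c + k * k) * (k * E * (sN * c + cN * s)))%C; [ring|].
    rewrite IH.
    transitivity (k * (k * E) * ((cN * c - sN * s) * s + (sN * c + cN * s) * (c - k))
      + k * k * E * sN * (s * s + c * c - RtoC 1))%C; [ring|].
    rewrite H. ring.
Qed.

(** * The zeros of the sines against the poles of the weight *)

Lemma sin_2_PI_nat n : sin (2 * INR n * PI) = 0.
Proof. pose proof (sin_period 0 n) as H. now rewrite Rplus_0_l, sin_0 in H. Qed.

Lemma cos_2_PI_nat n : cos (2 * INR n * PI) = 1.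
Proof. pose proof (cos_period 0 n) as H. now rewrite Rplus_0_l, cos_0 in H. Qed.

Definition raw_weight (n : nat) (x : R) : R := sin (2 * INR n * x) * (2 * x / (x ^ 2 - PI ^ 2)).

(** [2x / (x^2 - PI^2) = 1 / (x - PI) + 1 / (x + PI)], and [sin 2nx] is unchanged when [x] is
    shifted by [PI] either way. *)
Lemma raw_weight_eq n x : 0 <= x -> x <> PI -> raw_weight n x = series_weight n x.
Proof.
  intros Hx Hp. pose proof PI_RGT_0. unfold raw_weight, series_weight, sinc_scaled.
  destruct (Req_EM_T (x - PI) 0); [lra|]. destruct (Req_EM_T (x + PI) 0); [lra|].
  replace (2 * INR n * (x - PI)) with (2 * INR n * x - 2 * INR n * PI) by ring.
  replace (2 * INR n * (x + PI)) with (2 * INR n * x + 2 * INR n * PI) by ring.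
  pose proof (sin_2_PI_nat n) as Hs. pose proof (cos_2_PI_nat n) as Hc.
  rewrite sin_minus, sin_plus, Hs, Hc. field. split; [|split]; nra.
Qed.

(** [sin 2nx] vanishes at [0], [PI] and [-PI], which gives three bounds linear in the distance to
    one zero, the third being a weakening of the first. The partial fractions of
    [1 / (x (x^2 - PI^2))] combine them into one bound by the product of the distances. *)
Lemma sin_multiple_bound n x : 0 < x ->
  Rabs (sin (2 * INR n * x)) <= INR n * x * Rabs (x ^ 2 - PI ^ 2).
Proof.
  intros Hx. pose proof PI2_3_2 as HP. pose proof (pos_INR n) as Hn.
  pose proof (sin_2_PI_nat n) as Hs. pose proof (cos_2_PI_nat n) as Hc.
  assert (B0 : Rabs (sin (2 * INR n * x)) <= 2 * INR n * x).
  { eapply Rle_trans; [apply sin_lin_bound|]. rewrite Rabs_pos_eq; nra. }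
  assert (B1 : Rabs (sin (2 * INR n * x)) <= 2 * INR n * Rabs (x - PI)).
  { replace (sin (2 * INR n * x)) with (sin (2 * INR n * (x - PI))).
    - eapply Rle_trans; [apply sin_lin_bound|].
      rewrite Rabs_mult, (Rabs_pos_eq (2 * INR n)); lra.
    - replace (2 * INR n * (x - PI)) with (2 * INR n * x - 2 * INR n * PI) by ring.
      rewrite sin_minus, Hs, Hc; ring. }
  assert (B2 : Rabs (sin (2 * INR n * x)) <= 2 * INR n * (x + PI)) by nra.
  replace (x ^ 2 - PI ^ 2) with ((x - PI) * (x + PI)) by ring.
  rewrite Rabs_mult, (Rabs_pos_eq (x + PI)) by lra.
  set (s := sin (2 * INR n * x)) in *. set (d := Rabs (x - PI)) in *.
  assert (Hd : 0 <= d) by apply Rabs_pos. pose proof (Rabs_pos s).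
  (* [2 PI^2 = - 2 (x^2 - PI^2) + x (x + PI) + x (x - PI)]: partial fractions of
     [1 / (x (x^2 - PI^2))] with the denominators cleared. *)
  assert (I : 2 * (PI * PI) <= 2 * (d * (x + PI)) + x * (x + PI) + x * d).
  { assert (- d <= x - PI <= d) by (apply Rabs_le_between; unfold d; lra). nra. }
  assert (I2 : Rabs s * (2 * (PI * PI)) <= Rabs s * (2 * (d * (x + PI)) + x * (x + PI) + x * d))
    by (apply Rmult_le_compat_l; auto).
  set (P := INR n * x * (d * (x + PI))).
  assert (HP0 : 0 <= P).
  { unfold P. repeat apply Rmult_le_pos; lra. }
  assert (J0 : Rabs s * (2 * (d * (x + PI))) <= 4 * P).
  { unfold P. replace (4 * (INR n * x * (d * (x + PI)))) with ((2 * INR n * x) * (2 * (d * (x + PI)))) by ring.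
    apply Rmult_le_compat_r; auto. assert (0 <= d * (x + PI)) by (apply Rmult_le_pos; lra). lra. }
  assert (J1 : Rabs s * (x * (x + PI)) <= 2 * P).
  { unfold P. replace (2 * (INR n * x * (d * (x + PI)))) with ((2 * INR n * d) * (x * (x + PI))) by ring.
    apply Rmult_le_compat_r; auto. apply Rmult_le_pos; lra. }
  assert (J2 : Rabs s * (x * d) <= 2 * P).
  { unfold P. replace (2 * (INR n * x * (d * (x + PI)))) with ((2 * INR n * (x + PI)) * (x * d)) by ring.
    apply Rmult_le_compat_r; auto. apply Rmult_le_pos; lra. }
  (* The three parts add up to [8 P], while [2 PI^2 >= 18], so the factor 1 in front of [P] is
     reached with room to spare. *)
  assert (9 <= PI * PI) by nra.
  assert (Rabs s * (2 * (PI * PI)) <= 8 * P) by lra.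
  assert (Rabs s * 18 <= Rabs s * (2 * (PI * PI))) by (apply Rmult_le_compat_l; lra).
  lra.
Qed.

(* Like the integrand, it takes the junk value 0 at [x = PI], so that the
   pointwise bound on the remainder holds there as well. *)
Definition raw_term (a : C) (n : nat) (x : R) : C := (nome_pow a n x * RtoC (raw_weight n x))%C.

(** [cos 2x - q] is the mean of [e^(2ix) (1 - w_plus)] and [e^(-2ix) (1 - w_minus)], so each summand
    cancels one factor of the denominator. One power of [1 / (1 - |q|)] is left, against two in
    [den_inv_bound]. *)
Lemma cos_minus_nome_den (a : C) (x : R) : 0 < Re a -> 0 < x ->
  Cmod ((RtoC (cos (2 * x)) - nome a x) / kernel_den a x) <= / (1 - exp (- (2 * Re a * x))).
Proof.
  intros Ha Hx.
  pose proof (one_minus_w_minus_neq_0 a x Ha Hx) as Hm.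
  pose proof (one_minus_w_plus_neq_0 a x Ha Hx) as Hp.
  pose proof (exp_gap a x Ha Hx) as Hg.
  set (e := (RtoC (cos (2 * x)) + Ci * RtoC (sin (2 * x)))%C).
  set (e' := (RtoC (cos (2 * x)) - Ci * RtoC (sin (2 * x)))%C).
  assert (Hee : (e * e')%C = RtoC 1).
  { unfold e, e'. rewrite <- (sin2_cos2_C (2 * x)).
    set (s := RtoC (sin (2 * x))). set (c := RtoC (cos (2 * x))).
    transitivity (c * c - (Ci * Ci) * (s * s))%C; [ring|]. rewrite Ci_sqr. ring. }
  assert (Hs : (RtoC (cos (2 * x)) - nome a x)%C =
     ((e * (RtoC 1 - w_plus a x) + e' * (RtoC 1 - w_minus a x)) / RtoC 2)%C).
  { rewrite w_minus_eq, w_plus_eq. fold e e'.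
    transitivity ((e + e' - RtoC 2 * nome a x * (e * e')) / RtoC 2)%C; [|field].
    rewrite Hee. unfold e, e'. field. }
  assert (Ee : Cmod e = 1).
  { unfold e. rewrite <- exp_lin_Ci, Cmod_exp_lin. rewrite <- exp_0. f_equal. simpl; ring. }
  assert (Ee' : Cmod e' = 1).
  { unfold e'. rewrite <- exp_lin_Ci_conj, Cmod_exp_lin. rewrite <- exp_0. f_equal. simpl; ring. }
  replace ((RtoC (cos (2 * x)) - nome a x) / kernel_den a x)%C with
    ((e * / (RtoC 1 - w_minus a x) + e' * / (RtoC 1 - w_plus a x)) * RtoC (/ 2))%C.
  2:{ rewrite Hs, RtoC_inv by lra. unfold kernel_den. field. repeat split; auto. }
  rewrite Cmod_mult, Cmod_R, (Rabs_pos_eq (/ 2)) by lra.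
  pose proof (Cmod_triangle (e * / (RtoC 1 - w_minus a x)) (e' * / (RtoC 1 - w_plus a x))) as Ht.
  rewrite !Cmod_mult, Ee, Ee', !Rmult_1_l, !Cmod_inv in Ht by auto.
  assert (B1 : / Cmod (RtoC 1 - w_minus a x) <= / (1 - exp (- (2 * Re a * x)))).
  { apply Rinv_le_contravar; auto. rewrite <- Cmod_w_minus. apply Cmod_1_minus. }
  assert (B2 : / Cmod (RtoC 1 - w_plus a x) <= / (1 - exp (- (2 * Re a * x)))).
  { apply Rinv_le_contravar; auto. rewrite <- Cmod_w_plus. apply Cmod_1_minus. }
  lra.
Qed.

Lemma den_inv_bound (a : C) (x : R) : 0 < Re a -> 0 < x ->
  Cmod (/ kernel_den a x) <= / (1 - exp (- (2 * Re a * x))) * / (1 - exp (- (2 * Re a * x))).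
Proof.
  intros Ha Hx.
  pose proof (one_minus_w_minus_neq_0 a x Ha Hx) as Hm.
  pose proof (one_minus_w_plus_neq_0 a x Ha Hx) as Hp.
  pose proof (exp_gap a x Ha Hx) as Hg.
  rewrite Cmod_inv by (unfold kernel_den; now apply Cmult_neq_0).
  unfold kernel_den. rewrite Cmod_mult, Rinv_mult.
  apply Rmult_le_compat; try (left; apply Rinv_0_lt_compat; now apply Cmod_gt_0);
    apply Rinv_le_contravar; auto.
  - rewrite <- Cmod_w_minus. apply Cmod_1_minus.
  - rewrite <- Cmod_w_plus. apply Cmod_1_minus.
Qed.

Lemma remainder_eq (a : C) (N : nat) (x : R) : 0 < Re a -> 0 < x -> x <> PI ->
  (integrand a x - sum_n_m (G := C_AbelianMonoid) (fun n => raw_term a n x) 1 N)%C =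
  (RtoC (2 * x / (x ^ 2 - PI ^ 2)) * (nome a x * nome_pow a N x *
     (RtoC (cos (2 * INR N * x)) * RtoC (sin (2 * x)) * / kernel_den a x
      + RtoC (sin (2 * INR N * x)) * ((RtoC (cos (2 * x)) - nome a x) / kernel_den a x))))%C.
Proof.
  intros Ha Hx Hp. rewrite integrand_den by auto.
  assert (Hd : kernel_den a x <> RtoC 0).
  { apply Cmult_neq_0; [now apply one_minus_w_minus_neq_0|now apply one_minus_w_plus_neq_0]. }
  pose proof PI_RGT_0.
  assert (Hx2 : x ^ 2 - PI ^ 2 <> 0).
  { replace (x ^ 2 - PI ^ 2) with ((x - PI) * (x + PI)) by ring.
    apply Rmult_integral_contrapositive_currified; lra. }
  assert (Hsum : sum_n_m (G := C_AbelianMonoid) (fun n => raw_term a n x) 1 N =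
    (RtoC (2 * x / (x ^ 2 - PI ^ 2)) *
     sum_n_m (G := C_AbelianMonoid) (fun n => nome_pow a n x * RtoC (sin (2 * INR n * x)))%C 1 N)%C).
  { clear -x. induction N as [|N IH].
    - rewrite !sum_1_0. change (zero (G := C_AbelianMonoid)) with (RtoC 0). eq_C. ring.
    - rewrite !sum_1_S, IH. change (plus (G := C_AbelianMonoid)) with Cplus.
      unfold raw_term, raw_weight. rewrite (RtoC_mult (sin _)). eq_C. ring. }
  rewrite Hsum. clear Hsum.
  pose proof (geometric_sine_sum a N x) as HG.
  set (S := sum_n_m _ _ _) in *.
  set (R1 := (RtoC (cos (2 * INR N * x)) * RtoC (sin (2 * x)) +
        RtoC (sin (2 * INR N * x)) * (RtoC (cos (2 * x)) - nome a x))%C) in *.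
  transitivity (RtoC (2 * x / (x ^ 2 - PI ^ 2)) * ((nome a x * nome_pow a N x * R1) / kernel_den a x))%C.
  - rewrite <- HG. rewrite RtoC_div, RtoC_mult by auto. field. split; auto.
    intros E. apply RtoC_inj in E. auto.
  - unfold R1. field. auto.
Qed.

(** With [u = x / (1 - r)] and [be = 1 / (2 al)], the estimates [r u <= be] and [r u^2 <= 4 be^2]
    hold uniformly in [x]. The sum is at most [2 * 4 be^2 + 2 * be * 2 be = 12 be^2 = 3 / al^2]. The
    factor [1 * x] is the instance [n = 1] of the sine bound [n x]. *)
Lemma remainder_bound_aux (al x N : R) : 0 < al -> 0 < x -> 0 <= N ->
  let r := exp (- (2 * al * x)) in
  2 * x * (r * exp (- (2 * N * al * x)) *
    (1 * x * (/ (1 - r) * / (1 - r)) + N * x * / (1 - r)))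
  <= 3 / al ^ 2 * exp (- (al * N * x)).
Proof.
  intros Ha Hx HN r.
  set (y := 2 * al * x). assert (Hy : 0 < y) by (unfold y; nra).
  assert (Hr : 0 < r) by apply exp_pos.
  assert (Hr1 : r * exp y = 1).
  { unfold r. fold y. rewrite <- exp_plus, <- exp_0. f_equal. ring. }
  assert (E1 : 1 + y <= exp y) by apply exp_ineq1_le.
  (* Squaring [1 + y/2 <= e^(y/2)] gives [(2 + y)^2 <= 4 e^y]. *)
  assert (E2 : (1 + y) * (1 + y) <= 4 * exp y).
  { pose proof (exp_ineq1_le (y / 2)) as H.
    replace (exp y) with (exp (y / 2) * exp (y / 2)) by (rewrite <- exp_plus; f_equal; field).
    nra. }
  assert (F1 : r * (1 + y) <= 1) by (rewrite <- Hr1; apply Rmult_le_compat_l; lra).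
  assert (F2 : r * ((1 + y) * (1 + y)) <= 4).
  { replace 4 with (r * (4 * exp y)) by lra. apply Rmult_le_compat_l; lra. }
  assert (Hg : y <= (1 + y) * (1 - r)) by nra.
  assert (Hg1 : 0 < 1 - r) by nra.
  assert (G : x * / (1 - r) <= (1 + y) * / (2 * al)).
  { apply Rmult_le_reg_r with (1 - r); auto. rewrite Rmult_assoc, Rinv_l, Rmult_1_r by lra.
    apply Rmult_le_reg_r with (2 * al); [lra|].
    replace ((1 + y) * / (2 * al) * (1 - r) * (2 * al)) with ((1 + y) * (1 - r)) by (field; lra).
    unfold y in *. lra. }
  assert (G0 : 0 <= x * / (1 - r)) by (apply Rle_mult_inv_pos; lra).
  set (u := x * / (1 - r)) in *. set (be := / (2 * al)) in *.
  assert (Hbe : 0 < be) by (apply Rinv_0_lt_compat; lra).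
  assert (U1 : r * u <= be).
  { apply Rle_trans with (r * ((1 + y) * be)); [apply Rmult_le_compat_l; lra|].
    rewrite <- Rmult_assoc. nra. }
  assert (U2 : r * (u * u) <= 4 * (be * be)).
  { apply Rle_trans with (r * (((1 + y) * be) * ((1 + y) * be))).
    - apply Rmult_le_compat_l; [lra|]. apply Rmult_le_compat; lra.
    - replace (r * ((1 + y) * be * ((1 + y) * be))) with (r * ((1 + y) * (1 + y)) * (be * be)) by ring.
      apply Rmult_le_compat_r; nra. }
  (* The exponential is split into two equal factors: one absorbs the growth of [N * x], the other
     is the decay kept in the conclusion. *)
  set (ee := exp (- (al * N * x))).
  assert (He : 0 < ee) by apply exp_pos.
  assert (Hee : exp (- (2 * N * al * x)) = ee * ee).
  { unfold ee. rewrite <- exp_plus. f_equal. ring. }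
  rewrite Hee.
  assert (H1 : ee * exp (al * N * x) = 1).
  { unfold ee. rewrite <- exp_plus, <- exp_0. f_equal. ring. }
  pose proof (exp_ineq1_le (al * N * x)) as H2.
  assert (HNx : 0 <= N * x) by nra.
  assert (HaNx : 0 <= al * N * x) by (rewrite Rmult_assoc; apply Rmult_le_pos; lra).
  assert (V0 : ee * (1 + al * N * x) <= 1) by (rewrite <- H1; apply Rmult_le_compat_l; lra).
  assert (0 <= ee * (al * N * x)) by (apply Rmult_le_pos; lra).
  assert (V1 : ee <= 1) by lra.
  assert (V2 : ee * (N * x) <= 2 * be).
  { assert (ee * (al * N * x) <= 1) by lra.
    apply Rmult_le_reg_r with al; auto.
    replace (2 * be * al) with 1 by (unfold be; field; lra). lra. }
  replace (2 * x * (r * (ee * ee) * (1 * x * (/ (1 - r) * / (1 - r)) + N * x * / (1 - r))))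
    with (ee * (2 * (r * (u * u)) * ee + 2 * (r * u) * (ee * (N * x)))) by (unfold u; ring).
  replace (3 / al ^ 2 * ee) with (ee * (12 * (be * be))) by (unfold be; field; lra).
  apply Rmult_le_compat_l; [lra|].
  assert (W1 : r * (u * u) * ee <= 4 * (be * be)).
  { assert (0 <= r * (u * u)) by (apply Rmult_le_pos; nra). nra. }
  assert (W2 : (r * u) * (ee * (N * x)) <= be * (2 * be)).
  { apply Rmult_le_compat; auto; apply Rmult_le_pos; lra. }
  nra.
Qed.

Lemma integrand_sin_0 a x : sin (2 * x) = 0 -> integrand a x = RtoC 0.
Proof. intros H. unfold integrand. rewrite H. unfold Cdiv. ring. Qed.

Lemma raw_term_sin_0 a n x : sin (2 * INR n * x) = 0 -> raw_term a n x = RtoC 0.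
Proof. intros H. unfold raw_term, raw_weight. rewrite H, Rmult_0_l. ring. Qed.

Lemma remainder_bound (a : C) (N : nat) (x : R) : 0 < Re a -> 0 <= x ->
  Cmod (integrand a x - sum_n_m (G := C_AbelianMonoid) (fun n => raw_term a n x) 1 N)
    <= 3 / Re a ^ 2 * exp (- (Re a * INR N * x)).
Proof.
  intros Ha Hx.
  assert (Hpos : 0 <= 3 / Re a ^ 2 * exp (- (Re a * INR N * x))).
  { apply Rmult_le_pos; [apply Rle_mult_inv_pos; nra|left; apply exp_pos]. }
  (* At [x = 0] and [x = PI] all the sines vanish, so whatever value the division takes there, the
     integrand and every term are 0. *)
  assert (Hz : (forall n, sin (2 * INR n * x) = 0) ->
    Cmod (integrand a x - sum_n_m (G := C_AbelianMonoid) (fun n => raw_term a n x) 1 N) = 0).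
  { intros H. rewrite integrand_sin_0.
    2:{ rewrite <- (H 1%nat). f_equal. simpl. ring. }
    replace (sum_n_m (G := C_AbelianMonoid) (fun n => raw_term a n x) 1 N) with (RtoC 0).
    - rewrite <- Cmod_0. f_equal. ring.
    - symmetry. rewrite (sum_n_m_ext (G := C_AbelianMonoid) _ (fun _ => zero)).
      + apply (sum_n_m_const_zero (G := C_AbelianMonoid)).
      + intros n. now apply raw_term_sin_0. }
  destruct (Req_dec x 0) as [->|Hx0].
  { rewrite Hz; auto. intros n. now rewrite Rmult_0_r, sin_0. }
  destruct (Req_dec x PI) as [->|Hxp].
  { rewrite Hz; auto. intros n. apply sin_2_PI_nat. }
  assert (Hx' : 0 < x) by lra. clear Hz Hpos.
  rewrite remainder_eq by auto. rewrite !Cmod_mult, Cmod_R, Cmod_nome, Cmod_nome_pow.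
  eapply Rle_trans; [|apply (remainder_bound_aux (Re a) x (INR N) Ha Hx' (pos_INR N))].
  set (r := exp (- (2 * Re a * x))).
  pose proof PI_RGT_0.
  assert (Hx2 : x ^ 2 - PI ^ 2 <> 0).
  { replace (x ^ 2 - PI ^ 2) with ((x - PI) * (x + PI)) by ring.
    apply Rmult_integral_contrapositive_currified; lra. }
  set (D := x ^ 2 - PI ^ 2) in *.
  assert (HD : 0 < Rabs D) by now apply Rabs_pos_lt.
  unfold Rdiv at 1. rewrite Rabs_mult, Rabs_inv, (Rabs_pos_eq (2 * x)) by lra.
  assert (Hr : 0 < r) by apply exp_pos.
  assert (Hg : 0 < 1 - r) by now apply exp_gap.
  assert (Hgi : 0 < / (1 - r)) by now apply Rinv_0_lt_compat.
  assert (HE := exp_pos (- (2 * INR N * Re a * x))).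
  set (E := exp (- (2 * INR N * Re a * x))) in *.
  assert (HS : forall n, Rabs (sin (2 * INR n * x)) <= INR n * x * Rabs D).
  { intros n. now apply sin_multiple_bound. }
  assert (HS1 : Rabs (sin (2 * x)) <= x * Rabs D).
  { specialize (HS 1%nat). simpl in HS. rewrite Rmult_1_r, Rmult_1_l in HS. exact HS. }
  assert (T : Cmod (RtoC (cos (2 * INR N * x)) * RtoC (sin (2 * x)) * / kernel_den a x +
       RtoC (sin (2 * INR N * x)) * ((RtoC (cos (2 * x)) - nome a x) / kernel_den a x))
     <= Rabs D * (1 * x * (/ (1 - r) * / (1 - r)) + INR N * x * / (1 - r))).
  { eapply Rle_trans; [apply Cmod_triangle|].
    rewrite !Cmod_mult, !Cmod_R.
    rewrite Rmult_plus_distr_l. apply Rplus_le_compat.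
    - replace (Rabs D * (1 * x * (/ (1 - r) * / (1 - r)))) with
        ((x * Rabs D) * (/ (1 - r) * / (1 - r))) by ring.
      apply Rmult_le_compat; [apply Rmult_le_pos; apply Rabs_pos|apply Cmod_ge_0| |now apply den_inv_bound].
      assert (Rabs (cos (2 * INR N * x)) <= 1) by (apply Rabs_le, COS_bound).
      pose proof (Rabs_pos (sin (2 * x))). nra.
    - replace (Rabs D * (INR N * x * / (1 - r))) with ((INR N * x * Rabs D) * / (1 - r)) by ring.
      apply Rmult_le_compat; [apply Rabs_pos|apply Cmod_ge_0|apply HS|].
      now apply cos_minus_nome_den. }
  set (K := 1 * x * (/ (1 - r) * / (1 - r)) + INR N * x * / (1 - r)) in *.
  replace (2 * x * (r * E * K)) with (2 * x * / Rabs D * (r * E * (Rabs D * K))) by (field; lra).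
  apply Rmult_le_compat_l.
  - apply Rle_mult_inv_pos; lra.
  - apply Rmult_le_compat_l; [nra|]. exact T.
Qed.

(** * Integrability and the limit *)

Lemma continuous_RtoC (f : R -> R) (x : R) :
  continuous f x -> continuous (T := R_UniformSpace) (U := C_UniformSpace) (fun t => RtoC (f t)) x.
Proof. intros H. apply continuous_C; simpl; auto. apply continuous_const. Qed.

Lemma continuous_fst_C (f : R -> C) (x : R) :
  continuous (U := C_UniformSpace) f x -> continuous (fun t => fst (f t)) x.
Proof. intros H. apply (continuous_comp f fst); auto. apply continuous_fst. Qed.

Lemma continuous_snd_C (f : R -> C) (x : R) :
  continuous (U := C_UniformSpace) f x -> continuous (fun t => snd (f t)) x.
Proof. intros H. apply (continuous_comp f snd); auto. apply continuous_snd. Qed.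

Lemma continuous_Cmult (f g : R -> C) (x : R) :
  continuous (U := C_UniformSpace) f x -> continuous (U := C_UniformSpace) g x ->
  continuous (U := C_UniformSpace) (fun t => f t * g t)%C x.
Proof.
  intros Hf Hg.
  pose proof (continuous_fst_C f x Hf). pose proof (continuous_snd_C f x Hf).
  pose proof (continuous_fst_C g x Hg). pose proof (continuous_snd_C g x Hg).
  apply continuous_C; simpl.
  - apply (continuous_minus (V := R_NormedModule)); now apply (continuous_mult (K := R_AbsRing)).
  - apply (continuous_plus (V := R_NormedModule)); now apply (continuous_mult (K := R_AbsRing)).
Qed.

Lemma continuous_Cinv (f : R -> C) (x : R) :
  continuous (U := C_UniformSpace) f x -> f x <> RtoC 0 ->
  continuous (U := C_UniformSpace) (fun t => / f t)%C x.
Proof.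
  intros Hf H0.
  pose proof (continuous_fst_C f x Hf) as H1. pose proof (continuous_snd_C f x Hf) as H2.
  assert (Hn : fst (f x) ^ 2 + snd (f x) ^ 2 <> 0).
  { intros E. apply H0. destruct (f x) as [u v]; simpl in *. unfold RtoC. f_equal; nra. }
  assert (Hd : continuous (fun t => / (fst (f t) ^ 2 + snd (f t) ^ 2)) x).
  { apply (continuous_comp (fun t => fst (f t) ^ 2 + snd (f t) ^ 2) Rinv).
    - apply (continuous_plus (V := R_NormedModule)).
      + apply (continuous_ext (fun t => fst (f t) * fst (f t))); [intros; simpl; ring|].
        now apply (continuous_mult (K := R_AbsRing)).
      + apply (continuous_ext (fun t => snd (f t) * snd (f t))); [intros; simpl; ring|].
        now apply (continuous_mult (K := R_AbsRing)).
    - now apply continuous_Rinv. }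
  apply continuous_C; simpl; unfold Rdiv; apply (continuous_mult (K := R_AbsRing)); auto.
  now apply (continuous_opp (V := R_NormedModule)).
Qed.

(** * Removable singularities as difference quotients *)

Definition slope (f : R -> R) (x0 l x : R) : R :=
  if Req_EM_T x x0 then l else (f x - f x0) / (x - x0).

Lemma slope_neq f x0 l x : x <> x0 -> slope f x0 l x = (f x - f x0) / (x - x0).
Proof. intros H. unfold slope. now destruct (Req_EM_T x x0). Qed.

Lemma slope_eq f x0 l : slope f x0 l x0 = l.
Proof. unfold slope. now destruct (Req_EM_T x0 x0). Qed.

Lemma continuous_slope (f : R -> R) (x0 l x : R) :
  is_derive f x0 l -> continuous f x -> continuous (slope f x0 l) x.
Proof.
  intros Hd Hc. destruct (Req_dec x x0) as [->|Hx].
  - apply continuity_pt_filterlim. intros eps Heps.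
    apply is_derive_Reals in Hd. destruct (Hd eps Heps) as [d Hd'].
    exists d; split; [apply d|]. intros y [[_ Hy] Hyd]. simpl in *. unfold R_dist in *.
    rewrite slope_eq, slope_neq by auto.
    specialize (Hd' (y - x0)). replace (x0 + (y - x0)) with y in Hd' by ring.
    apply Hd'; auto; lra.
  - apply continuous_ext_loc with (fun y => (f y - f x0) / (y - x0)).
    + assert (Hp : 0 < Rabs (x - x0)) by (apply Rabs_pos_lt; lra).
      exists (mkposreal _ Hp). intros y Hy. symmetry. apply slope_neq.
      intros ->. unfold ball in Hy; simpl in Hy. unfold AbsRing_ball, abs, minus, plus, opp in Hy; simpl in Hy.
      rewrite Rabs_minus_sym in Hy. unfold Rminus in Hy. lra.
    + unfold Rdiv. apply (continuous_mult (K := R_AbsRing)).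
      * apply (continuous_minus (V := R_NormedModule)); auto. apply continuous_const.
      * apply (ex_derive_continuous (V := R_NormedModule)). auto_derive. lra.
Qed.

(* [(1 - e^(-z x)) / x], continued by [z] at [0]. *)
Definition exp_slope (z : C) (x : R) : C :=
  (slope (fun t => - (exp (- (Re z * t)) * cos (Im z * t))) 0 (Re z) x,
   slope (fun t => exp (- (Re z * t)) * sin (Im z * t)) 0 (Im z) x).

Lemma continuous_exp_slope z x : continuous (U := C_UniformSpace) (exp_slope z) x.
Proof.
  apply continuous_C; simpl; apply continuous_slope.
  - auto_derive; auto. rewrite !Rmult_0_r, Ropp_0, exp_0, cos_0, sin_0. ring.
  - apply (ex_derive_continuous (V := R_NormedModule)). auto_derive; auto.
  - auto_derive; auto. rewrite !Rmult_0_r, Ropp_0, exp_0, cos_0, sin_0. ring.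
  - apply (ex_derive_continuous (V := R_NormedModule)). auto_derive; auto.
Qed.

Lemma exp_slope_0 z : exp_slope z 0 = z.
Proof. unfold exp_slope. rewrite !slope_eq. now destruct z. Qed.

Lemma exp_slope_neq z x : x <> 0 -> (RtoC 1 - exp_lin z x)%C = (RtoC x * exp_slope z x)%C.
Proof.
  intros Hx. unfold exp_slope. rewrite !slope_neq by auto.
  rewrite !Rmult_0_r, Ropp_0, exp_0, cos_0, sin_0.
  unfold exp_lin, Cexp. destruct z as [u v]. simpl.
  replace (- (u * x - v * 0)) with (- (u * x)) by ring.
  replace (- (u * 0 + v * x)) with (- (v * x)) by ring.
  rewrite cos_neg, sin_neg.
  unfold Cminus, Cplus, Copp, Cmult, RtoC; simpl. f_equal; field; auto.
Qed.

Lemma continuous_exp_lin z x : continuous (U := C_UniformSpace) (exp_lin z) x.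
Proof.
  apply (continuous_ext (fun t => RtoC 1 * Cexp (- z * RtoC t))%C).
  - intros t. unfold exp_lin. replace (- (z * RtoC t))%C with (- z * RtoC t)%C by ring. eq_C. ring.
  - apply continuous_Cexp_lin.
Qed.

Lemma continuous_one_minus_exp_lin z x :
  continuous (U := C_UniformSpace) (fun t => RtoC 1 - exp_lin z t)%C x.
Proof.
  apply (continuous_minus (V := C_R_NormedModule)); [apply continuous_const|apply continuous_exp_lin].
Qed.

(** The double zero of the denominator at 0 is met by [sin 2x] and by [x]. Dividing the sine and
    both factors of [kernel_den] by [x] gives a function continuous on [[0, 1]]. *)
Lemma ex_RInt_integrand_left (a : C) : 0 < Re a ->
  ex_RInt (V := C_R_NormedModule) (integrand a) 0 1.
Proof.
  intros Ha. pose proof PI2_3_2 as HP.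
  set (S1 := exp_slope (RtoC 2 * (a - Ci))%C). set (S2 := exp_slope (RtoC 2 * (a + Ci))%C).
  set (sl := slope (fun t => sin (2 * t)) 0 2).
  apply ex_RInt_ext with (fun x => RtoC (sl x) * (RtoC 2 * nome a x) * / (S1 x * S2 x)
     * RtoC (/ (x ^ 2 - PI ^ 2)))%C.
  - intros x. rewrite Rmin_left, Rmax_right by lra. intros Hx.
    rewrite integrand_den by lra. eq_C. unfold kernel_den, w_minus, w_plus, sl.
    assert (H1 := one_minus_w_minus_neq_0 a x Ha ltac:(lra)).
    assert (H2 := one_minus_w_plus_neq_0 a x Ha ltac:(lra)).
    unfold w_minus in H1. unfold w_plus in H2.
    rewrite exp_slope_neq in H1 by lra. rewrite exp_slope_neq in H2 by lra.
    rewrite !exp_slope_neq by lra. fold S1 S2 in H1, H2 |- *.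
    assert (Hx0 : RtoC x <> RtoC 0) by (intros E; apply RtoC_inj in E; lra).
    assert (H1' : S1 x <> RtoC 0) by (intros E; apply H1; rewrite E; ring).
    assert (H2' : S2 x <> RtoC 0) by (intros E; apply H2; rewrite E; ring).
    rewrite slope_neq by lra. rewrite Rmult_0_r, sin_0, !Rminus_0_r.
    assert (Hd : x ^ 2 - PI ^ 2 <> 0) by nra.
    rewrite RtoC_div, RtoC_inv by lra.
    field. repeat split; auto. intros E; apply RtoC_inj in E; lra.
  - apply (ex_RInt_continuous (V := C_R_CompleteNormedModule)).
    intros x. rewrite Rmin_left, Rmax_right by lra. intros Hx.
    apply continuous_Cmult; [apply continuous_Cmult; [apply continuous_Cmult; [|apply continuous_Cmult]|]|].
    + apply continuous_RtoC, continuous_slope.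
      * auto_derive; auto. rewrite Rmult_0_r, cos_0. ring.
      * apply (ex_derive_continuous (V := R_NormedModule)). auto_derive; auto.
    + apply continuous_RtoC, continuous_const.
    + apply continuous_exp_lin.
    + apply continuous_Cinv.
      * apply continuous_Cmult; apply continuous_exp_slope.
      (* At 0 the product is [4 (a - i) (a + i)], nonzero since both factors have positive real
         part. *)
      * destruct (Req_dec x 0) as [->|Hx0].
        -- unfold S1, S2. rewrite !exp_slope_0.
           apply Cmult_neq_0; apply Re_pos_neq_0; destruct a; simpl in *; lra.
        -- assert (H1 := one_minus_w_minus_neq_0 a x Ha ltac:(lra)).
           assert (H2 := one_minus_w_plus_neq_0 a x Ha ltac:(lra)).
           unfold w_minus in H1. unfold w_plus in H2.
           rewrite exp_slope_neq in H1 by lra. rewrite exp_slope_neq in H2 by lra.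
           fold S1 in H1. fold S2 in H2.
           intros E. apply (Cmult_neq_0 _ _ H1 H2).
           transitivity (RtoC x * RtoC x * (S1 x * S2 x))%C; [ring|]. rewrite E. ring.
    + apply continuous_RtoC, (ex_derive_continuous (V := R_NormedModule)).
      auto_derive. nra.
Qed.

(** The continuous extension agrees with [integrand] off [PI], and [ex_RInt_ext] compares functions
    on an open interval only; hence [PI] must not be an interior point. *)
Lemma ex_RInt_integrand_right (a : C) (b1 b2 : R) : 0 < Re a -> 1 <= b1 <= b2 ->
  (b2 <= PI \/ PI <= b1) ->
  ex_RInt (V := C_R_NormedModule) (integrand a) b1 b2.
Proof.
  intros Ha Hb Hpi. pose proof PI2_3_2 as HP.
  set (sl := slope (fun t => sin (2 * t)) PI 2).
  apply ex_RInt_ext with (fun x => RtoC (sl x) * (RtoC 2 * nome a x) * / kernel_den a x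
     * RtoC (x / (x + PI)))%C.
  - intros x. rewrite Rmin_left, Rmax_right by lra. intros Hx.
    rewrite integrand_den by lra. eq_C. unfold sl.
    rewrite slope_neq by lra. rewrite sin_2PI, Rminus_0_r.
    assert (Hd : kernel_den a x <> RtoC 0).
    { apply Cmult_neq_0; [apply one_minus_w_minus_neq_0|apply one_minus_w_plus_neq_0]; auto; lra. }
    replace (x ^ 2 - PI ^ 2) with ((x - PI) * (x + PI)) by ring.
    rewrite !RtoC_div, RtoC_mult by lra.
    field. repeat split; auto; intros E; apply RtoC_inj in E; lra.
  - apply (ex_RInt_continuous (V := C_R_CompleteNormedModule)).
    intros x. rewrite Rmin_left, Rmax_right by lra. intros Hx.
    apply continuous_Cmult; [apply continuous_Cmult; [apply continuous_Cmult; [|apply continuous_Cmult]|]|].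
    + apply continuous_RtoC, continuous_slope.
      * auto_derive; auto. rewrite cos_2PI. ring.
      * apply (ex_derive_continuous (V := R_NormedModule)). auto_derive; auto.
    + apply continuous_RtoC, continuous_const.
    + apply continuous_exp_lin.
    + apply continuous_Cinv.
      * apply continuous_Cmult; apply continuous_one_minus_exp_lin.
      * apply Cmult_neq_0; [apply one_minus_w_minus_neq_0|apply one_minus_w_plus_neq_0]; auto; lra.
    + apply continuous_RtoC, (ex_derive_continuous (V := R_NormedModule)).
      auto_derive. lra.
Qed.

Lemma ex_RInt_integrand (a : C) (b : R) : 0 < Re a -> PI <= b ->
  ex_RInt (V := C_R_NormedModule) (integrand a) 0 b.
Proof.
  intros Ha Hb. pose proof PI2_3_2 as HP.
  apply ex_RInt_Chasles with PI.
  - apply ex_RInt_Chasles with 1; [now apply ex_RInt_integrand_left|].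
    apply ex_RInt_integrand_right; auto; lra.
  - apply ex_RInt_integrand_right; auto; lra.
Qed.

(** Cutting at [c] turns the exceptional point into an endpoint, where [is_RInt_ext] asks
    nothing. *)
Lemma is_RInt_ext_except (f g : R -> C) (a b c : R) (l : C) : a <= c <= b ->
  (forall x, a < x < b -> x <> c -> f x = g x) ->
  is_RInt (V := C_R_NormedModule) f a b l -> is_RInt (V := C_R_NormedModule) g a b l.
Proof.
  intros Hc Hfg Hf.
  assert (Hex : ex_RInt (V := C_R_NormedModule) f a b) by (eexists; apply Hf).
  assert (H1 := ex_RInt_Chasles_1 (V := C_R_CompleteNormedModule) f a c b Hc Hex).
  assert (H2 := ex_RInt_Chasles_2 (V := C_R_CompleteNormedModule) f a c b Hc Hex).
  destruct H1 as [l1 H1]. destruct H2 as [l2 H2].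
  assert (E : l = plus (G := C_R_NormedModule) l1 l2).
  { pose proof (is_RInt_Chasles (V := C_R_NormedModule) f a c b l1 l2 H1 H2) as H3.
    rewrite <- (is_RInt_unique (V := C_R_CompleteNormedModule) f a b l Hf).
    now apply (is_RInt_unique (V := C_R_CompleteNormedModule)). }
  rewrite E. apply is_RInt_Chasles with c.
  - apply is_RInt_ext with f; auto. intros x. rewrite Rmin_left, Rmax_right by lra.
    intros Hx; apply Hfg; lra.
  - apply is_RInt_ext with f; auto. intros x. rewrite Rmin_left, Rmax_right by lra.
    intros Hx; apply Hfg; lra.
Qed.

(** * Integrals of the partial sums and of the remainder *)

Lemma raw_term_integral (a : C) (n : nat) (b : R) : 0 < Re a -> (1 <= n)%nat -> PI <= b ->
  exists l,
    is_RInt (V := C_R_NormedModule) (raw_term a n) 0 b l /\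
    Cmod (l - fourier_coeff a n) <= 2 * exp (- (2 * INR n * Re a * b)) / Re a.
Proof.
  intros Ha Hn Hb. pose proof PI_RGT_0.
  destruct (term_integral a n b _ Ha Hn (is_RInt_fourier_coeff a n Ha)) as [l [Hl Hb']].
  exists l; split; auto.
  revert Hl. apply (is_RInt_ext_except _ _ 0 b PI); [lra|].
  intros x Hx Hp. unfold raw_term, nome_pow. now rewrite raw_weight_eq by lra.
Qed.

(** Every error is replaced by the one for [n = 1], the largest. The resulting factor [INR N] is
    harmless, as [b] is chosen after [N]. *)
Lemma raw_sum_integral (a : C) (N : nat) (b : R) : 0 < Re a -> PI <= b ->
  exists l,
    is_RInt (V := C_R_NormedModule)
      (fun x => sum_n_m (G := C_AbelianMonoid) (fun n => raw_term a n x) 1 N) 0 b l /\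
    Cmod (l - sum_n_m (G := C_AbelianMonoid) (fourier_coeff a) 1 N)
      <= INR N * (2 * exp (- (2 * Re a * b)) / Re a).
Proof.
  intros Ha Hb. pose proof PI_RGT_0. induction N as [|N [l [Hl HN]]].
  - exists (RtoC 0). rewrite sum_1_0. change (zero (G := C_AbelianMonoid)) with (RtoC 0). split.
    + eapply is_RInt_ext; [intros x _; symmetry; apply (sum_1_0 (G := C_AbelianMonoid))|].
      pose proof (is_RInt_const (V := C_R_NormedModule) 0 b (RtoC 0)) as H0.
      assert (E : scal (V := C_R_NormedModule) (b - 0) (RtoC 0) = RtoC 0)
        by apply (scal_zero_r (V := C_R_NormedModule)).
      exact (eq_ind _ (is_RInt (V := C_R_NormedModule) (fun _ => RtoC 0) 0 b) H0 _ E).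
    + replace (RtoC 0 - RtoC 0)%C with (RtoC 0) by ring. rewrite Cmod_0. simpl. lra.
  - destruct (raw_term_integral a (S N) b Ha ltac:(lia) Hb) as [l' [Hl' HB]].
    exists (l + l')%C. split.
    + eapply is_RInt_ext; [intros x _; symmetry; apply (sum_1_S (G := C_AbelianMonoid))|].
      apply (is_RInt_plus (V := C_R_NormedModule)); auto.
    + rewrite sum_1_S. change (plus (G := C_AbelianMonoid)) with Cplus.
      set (s := sum_n_m _ _ _) in *.
      replace (l + l' - (s + fourier_coeff a (S N)))%C with ((l - s) + (l' - fourier_coeff a (S N)))%C by ring.
      eapply Rle_trans; [apply Cmod_triangle|].
      assert (Hmono : 2 * exp (- (2 * INR (S N) * Re a * b)) / Re a <= 2 * exp (- (2 * Re a * b)) / Re a).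
      { unfold Rdiv. apply Rmult_le_compat_r; [left; now apply Rinv_0_lt_compat|].
        apply Rmult_le_compat_l; [lra|].
        assert (Hle : 2 * Re a * b <= 2 * INR (S N) * Re a * b).
        { rewrite S_INR. pose proof (pos_INR N).
          assert (0 <= INR N * (Re a * b)) by (apply Rmult_le_pos; nra). lra. }
        destruct Hle as [Hlt|Heq]; [left; apply exp_increasing; lra|right; f_equal; lra]. }
      rewrite S_INR, Rmult_plus_distr_r, Rmult_1_l. lra.
Qed.

(** The exponential majorant integrates to at most its integral over the half-line, so that the
    bound is free of [b]. *)
Lemma remainder_integral (a : C) (N : nat) (b : R) (l : C) : 0 < Re a -> 0 <= b -> (1 <= N)%nat ->
  is_RInt (V := C_R_NormedModule)
    (fun x => integrand a x - sum_n_m (G := C_AbelianMonoid) (fun n => raw_term a n x) 1 N)%C 0 b l ->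
  Cmod l <= 3 / (Re a ^ 3 * INR N).
Proof.
  intros Ha Hb HN Hl. assert (HNp : 0 < INR N) by (apply lt_0_INR; lia).
  set (al := Re a) in *. set (k := al * INR N).
  assert (Hk : 0 < k) by (unfold k; now apply Rmult_lt_0_compat).
  assert (HI : is_RInt (fun x => 3 / al ^ 2 * exp (- (k * x))) 0 b
    (minus (- (3 / al ^ 2 / k * exp (- (k * b)))) (- (3 / al ^ 2 / k * exp (- (k * 0)))))).
  { apply (is_RInt_derive (V := R_CompleteNormedModule) (fun x => - (3 / al ^ 2 / k * exp (- (k * x))))).
    - intros x _. auto_derive; auto. field. split; lra.
    - intros x _. apply (ex_derive_continuous (V := R_NormedModule)). auto_derive; auto. }
  pose proof (norm_RInt_le (V := C_R_NormedModule) _ _ 0 b l _ Hb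
    (fun x Hx => Rle_trans _ _ _ (Req_le _ _ (norm_Cmod _))
      (remainder_bound a N x Ha (proj1 Hx))) Hl HI) as H.
  rewrite norm_Cmod in H. eapply Rle_trans; [apply H|].
  assert (Hm : forall u v : R, minus u v = u - v) by reflexivity.
  rewrite Hm, Rmult_0_r, Ropp_0, exp_0.
  assert (Hp : 0 < 3 / al ^ 2 / k) by (repeat apply Rdiv_lt_0_compat; try lra; nra).
  pose proof (exp_pos (- (k * b))).
  apply Rle_trans with (3 / al ^ 2 / k).
  - nra.
  - right. unfold k. field. split; lra.
Qed.

Lemma limit_value_approx (a : C) (eps : R) : 0 < Re a -> 0 < eps ->
  exists B, forall b, B < b -> exists l,
    is_RInt (V := C_R_NormedModule) (integrand a) 0 b l /\ Cmod (l - limit_value a) < eps.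
Proof.
  intros Ha Heps.
  destruct (fourier_coeff_sum a (eps / 3) Ha ltac:(lra)) as [N0 HN0].
  destruct (nfloor_ex (9 / (Re a ^ 3 * eps))) as [N1 [_ HN1]].
  { apply Rle_mult_inv_pos; [lra|]. apply Rmult_lt_0_compat; auto. apply pow_lt; auto. }
  (* The successor gives [1 <= N] and passes the integer part [N1], so that the remainder
     contributes less than [eps / 3]. *)
  set (N := S (max N0 N1)).
  assert (HN : INR N1 + 1 <= INR N) by (rewrite <- S_INR; apply le_INR; lia).
  pose proof (pos_INR N1).
  set (K := INR N * 2 / Re a).
  assert (HK : 0 < K) by (unfold K; apply Rdiv_lt_0_compat; lra).
  (* Beyond the second entry [K e^(-2 Re a b) < eps / 3], where [K e^(-2 Re a b)] is the error of
     the [N] truncated terms; the first puts [PI] inside the interval. *)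
  set (B := Rmax PI (- (ln (eps / (3 * K)) / (2 * Re a)))).
  exists B. intros b Hb.
  assert (Hbp : PI <= b) by (eapply Rle_trans; [apply Rmax_l|left; apply Hb]).
  pose proof PI_RGT_0.
  destruct (ex_RInt_integrand a b Ha Hbp) as [I HI].
  destruct (raw_sum_integral a N b Ha Hbp) as [s [Hs HsB]].
  exists I; split; auto.
  pose proof (is_RInt_minus (V := C_R_NormedModule) _ _ _ _ _ _ HI Hs) as HD.
  assert (HR : Cmod (I - s) <= 3 / (Re a ^ 3 * INR N)).
  { apply (remainder_integral a N b); auto; [lra|unfold N; lia]. }
  specialize (HN0 N ltac:(lia)).
  set (S := sum_n_m _ _ _) in *.
  replace (I - limit_value a)%C with ((I - s) + ((s - S) + (S - limit_value a)))%C by ring.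
  eapply Rle_lt_trans; [apply Cmod_triangle|].
  pose proof (Cmod_triangle (s - S) (S - limit_value a)).
  assert (Hal : 0 < Re a ^ 3) by now apply pow_lt.
  assert (T1 : 3 / (Re a ^ 3 * INR N) < eps / 3).
  { assert (Hlt : 9 / (Re a ^ 3 * eps) < INR N) by lra.
    apply Rmult_lt_compat_l with (r := Re a ^ 3 * eps) in Hlt; [|nra].
    replace (Re a ^ 3 * eps * (9 / (Re a ^ 3 * eps))) with 9 in Hlt by (field; split; nra).
    apply Rmult_lt_reg_r with (Re a ^ 3 * INR N); [nra|].
    replace (3 / (Re a ^ 3 * INR N) * (Re a ^ 3 * INR N)) with 3 by (field; split; nra). lra. }
  assert (T2 : INR N * (2 * exp (- (2 * Re a * b)) / Re a) < eps / 3).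
  { replace (INR N * (2 * exp (- (2 * Re a * b)) / Re a)) with (K * exp (- (2 * Re a * b)))
      by (unfold K; field; lra).
    assert (Hek : 0 < eps / (3 * K)) by (apply Rdiv_lt_0_compat; lra).
    assert (Hl : exp (- (2 * Re a * b)) < eps / (3 * K)).
    { rewrite <- (exp_ln (eps / (3 * K))) by auto. apply exp_increasing.
      assert (Hb2 : - (ln (eps / (3 * K)) / (2 * Re a)) < b)
        by (eapply Rle_lt_trans; [apply Rmax_r|apply Hb]).
      apply Rmult_lt_compat_l with (r := 2 * Re a) in Hb2; [|lra].
      replace (2 * Re a * - (ln (eps / (3 * K)) / (2 * Re a))) with (- ln (eps / (3 * K))) in Hb2
        by (field; lra). lra. }
    apply Rmult_lt_compat_l with (r := K) in Hl; auto.
    replace (K * (eps / (3 * K))) with (eps / 3) in Hl by (field; lra). exact Hl. }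
  lra.
Qed.

(* [at_point 0] and [Rbar_locally p_infty]: the limit, as b tends to +oo, of the
   proper Riemann integrals over [0, b] of a complex-valued function. *)
Theorem mainTheorem12 (a : C) (ha : (0 < Re a)%R) :
  is_RInt_gen (V := C_R_NormedModule) (integrand a)
    (at_point 0%R) (Rbar_locally p_infty)
    (RtoC 1 / (RtoC 2 * a)
       * ((RtoC 1 + RtoC 2 * (a * a)) / (RtoC 1 + a * a))
     - Catan (RtoC 1 / a))%C.
Proof.
  change (is_RInt_gen (V := C_R_NormedModule) (integrand a) (at_point 0)
    (Rbar_locally p_infty) (limit_value a)).
  intros P HP.
  (* The neighbourhood is shrunk to a ball of the norm, which is [Cmod]. *)
  destruct (locally_norm_le_locally (V := C_R_NormedModule) _ _ HP) as [eps Heps].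
  destruct (limit_value_approx a eps ha (cond_pos eps)) as [B HB].
  apply Filter_prod with (fun x => x = 0) (fun b => B < b).
  - reflexivity.
  - exists B. auto.
  - intros x b -> Hb. destruct (HB b Hb) as [l [Hl Hle]].
    exists l. split; auto. apply Heps. unfold ball_norm. rewrite norm_Cmod. exact Hle.
Qed.
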